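(* Let $m,n\ge0$ be integers and let $S$ be a symmetric complex $(m+n)\times(m+n)$ matrix whose real part is strictly negative definite. Then $$\mathfrak Z_m\,\mathcal B[S]\,\mathfrak Z_n^{-1}=\mathcal Q_{n,m}[S].$$
   Context: **Gauss operators.** For $S$ as in the claim, $\mathcal B[S]:L^2(\mathbb R^n)\to L^2(\mathbb R^m)$ is $$\mathcal B[S]f(x)=\frac1{(2\pi)^{(m+n)/4}}\int_{\mathbb R^n}\exp\Bigl\{\tfrac12\begin{pmatrix}x^t&y^t\end{pmatrix}S\begin{pmatrix}x\\ y\end{pmatrix}\Bigr\}f(y)\,dy,\qquad x\in\mathbb R^m;$$ it maps the Schwartz space $\mathcal S(\mathbb R^n)$ to $\mathcal S(\mathbb R^m)$. **Space $G(\mathbb R^{2n})$.** It consists of $g\in C^\infty(\mathbb R^{2n})$, written $g(x,\xi)$ with $x,\xi\in\mathbb R^n$, such that for all $k\in\mathbb Z^n$ $$g(x,\xi+2\pi k)=g(x,\xi),\qquad g(x+2\pi k,\xi)=e^{-ik\cdot\xi}g(x,\xi).$$ **Zak transform.** $\mathfrak Z_n:\mathcal S(\mathbb R^n)\to G(\mathbb R^{2n})$ is $$(\mathfrak Z_nf)(x,\xi)=\sum_{k\in\mathbb Z^n}f(x+2\pi k)e^{ik\cdot\xi};$$ it is invertible with inverse $(\mathfrak Z_n^{-1}g)(x)=\frac1{(2\pi)^n}\int_{\mathbb T^n}g(x,\xi)\,d\xi$, where $\mathbb T^n=\mathbb R^n/(2\pi\mathbb Z)^n$. **Operators with theta-kernels.**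 With $x,\xi\in\mathbb R^m$, $y,\eta\in\mathbb R^n$ and $b(x,y)=\frac12\begin{pmatrix}x^t&y^t\end{pmatrix}S\begin{pmatrix}x\\ y\end{pmatrix}$, put $$\mathcal K_{n,m}[S](x,\xi;y,\eta)=\sum_{k\in\mathbb Z^m}\sum_{l\in\mathbb Z^n}\exp\{b(x+2\pi k,y+2\pi l)\}\,e^{ik\cdot\xi}e^{-il\cdot\eta},$$ and let $\mathcal Q_{n,m}[S]:G(\mathbb R^{2n})\to G(\mathbb R^{2m})$ be $$(\mathcal Q_{n,m}[S]g)(x,\xi)=\frac1{(2\pi)^{3(n+m)/4}}\int_{\mathbb T^{2n}}\mathcal K_{n,m}[S](x,\xi;y,\eta)\,g(y,\eta)\,dy\,d\eta ,$$ where $\mathbb T^{2n}=\mathbb R^{2n}/(2\pi\mathbb Z)^{2n}$, i.e. the integral is over $[0,2\pi]^{2n}$.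
   Formalization: With the constants as given the identity fails for m ≠ n (e.g. n=0, m=1, S=(-1), g=1); what is proved is Z_m B[S] Z_n^{-1} = (2π)^{(m-n)/2} Q_{n,m}[S] for all m, n, which is the original identity when m = n. *)

(* Defs.v *)
From HB Require Import structures.
From mathcomp Require Import all_boot all_order all_algebra.
From mathcomp Require Import all_classical all_reals all_analysis.
From mathcomp Require Import complex.

Set Implicit Arguments.
Unset Strict Implicit.
Unset Printing Implicit Defensive.

Import Order.TTheory GRing.Theory Num.Theory.
Import numFieldNormedType.Exports.

Local Open Scope classical_set_scope.
Local Open Scope complex_scope.
Local Open Scope ring_scope.

Fact measure_rV_display : measure_display.
Proof. exact: default_measure_display. Qed.

(* The Borel sigma-algebra of R^n, generated by the coordinate maps. *)
Section measurable_rV.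
Context {R : realType}.
Variable n : nat.

Let coord (i : 'I_n) (v : 'rV[R]_n) : R := v ord0 i.

Let rV_set0 : g_sigma_preimage coord set0.
Proof. exact: sigma_algebra0. Qed.

Let rV_setC A : g_sigma_preimage coord A -> g_sigma_preimage coord (~` A).
Proof. exact: sigma_algebraC. Qed.

Let rV_bigcup (F : _^nat) : (forall i, g_sigma_preimage coord (F i)) ->
  g_sigma_preimage coord (\bigcup_i (F i)).
Proof. exact: sigma_algebra_bigcup. Qed.

HB.instance Definition _ := @isMeasurable.Build measure_rV_display
  'rV[R]_n (g_sigma_preimage coord) rV_set0 rV_setC rV_bigcup.

End measurable_rV.

Section lebesgue_rV.
Context {R : realType}.

Lemma measurable_coord n (i : 'I_n) :
  measurable_fun [set: 'rV[R]_n] (fun v : 'rV[R]_n => v ord0 i).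
Proof.
move=> _ Y mY; rewrite setTI; apply: sub_sigma_algebra => /=.
rewrite -bigcup_seq/=; exists i => /=; first by rewrite mem_index_enum.
by exists Y => //; rewrite setTI.
Qed.

Lemma measurable_fun_rVP d (T : measurableType d) n (f : T -> 'rV[R]_n) :
  (forall i, measurable_fun [set: T] (fun t => f t ord0 i)) ->
  measurable_fun [set: T] f.
Proof.
move=> mf; pose F := [set B : set 'rV[R]_n | measurable (f @^-1` B)].
move=> _ A mA; rewrite setTI.
suff : F A by [].
move: A mA; apply: smallest_sub => //=.
  split => [|A|G mG]; rewrite /F/=.
  - by rewrite preimage_set0.
  - by rewrite setTD preimage_setC => ?; exact: measurableC.
  - by rewrite preimage_bigcup; exact: bigcupT_measurable.
move=> B; rewrite -bigcup_seq/= => -[i _] [C mC <-].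
by rewrite /F/= setTI; have := mf i measurableT _ mC; rewrite setTI.
Qed.

Definition rV_cons n (p : measurableTypeR R * 'rV[R]_n) : 'rV[R]_(1 + n) :=
  row_mx (p.1)%:M p.2.

Lemma measurable_rV_cons n : measurable_fun setT (@rV_cons n).
Proof.
apply: measurable_fun_rVP => i; rewrite /rV_cons.
case: (split_ordP i) => j ->.
- rewrite (_ : (fun _ => _) = fst); first exact: measurable_fst.
  by apply: funext => p; rewrite row_mxEl (ord1 j) mxE eqxx mulr1n.
- rewrite (_ : (fun _ => _) = (fun v : 'rV[R]_n => v ord0 j) \o snd).
    exact: (measurableT_comp (measurable_coord j) measurable_snd).
  by apply: funext => p; rewrite row_mxEr.
Qed.

Definition rV_uncons n (v : 'rV[R]_(1 + n)) : measurableTypeR R * 'rV[R]_n :=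
  (v ord0 (lshift n ord0), rsubmx v).

Lemma rV_consK n : cancel (@rV_cons n) (@rV_uncons n).
Proof.
move=> -[a v]; rewrite /rV_uncons /rV_cons row_mxKr row_mxEl mxE eqxx.
by rewrite mulr1n.
Qed.

Lemma measurable_rV_uncons n : measurable_fun setT (@rV_uncons n).
Proof.
apply: measurable_fun_pair; first exact: measurable_coord.
apply: measurable_fun_rVP => i; rewrite (_ : (fun _ => _) =
  (fun v : 'rV[R]_(1 + n) => v ord0 (rshift 1 i))); first exact: measurable_coord.
by apply: funext => v; rewrite mxE.
Qed.

Section lebesgue_cons.
Variable n : nat.
Variable mu : {sigma_finite_measure set 'rV[R]_n -> \bar R}.

Definition lebesgue_cons : set 'rV[R]_(1 + n) -> \bar R :=
  pushforward (@lebesgue_measure R \x mu)%E (@rV_cons n).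

Let mcons A : measurable A -> measurable (@rV_cons n @^-1` A).
Proof. by rewrite -[X in _ -> measurable X]setTI; exact: measurable_rV_cons. Qed.

Let lebesgue_cons0 : lebesgue_cons set0 = 0%E.
Proof. by rewrite /lebesgue_cons /pushforward preimage_set0 measure0. Qed.

Let lebesgue_cons_ge0 A : (0 <= lebesgue_cons A)%E.
Proof.
exact: (measure_ge0 (@lebesgue_measure R \x mu)%E).
Qed.

Let lebesgue_cons_sigma_additive : semi_sigma_additive lebesgue_cons.
Proof.
move=> F mF tF mUF; rewrite /lebesgue_cons /pushforward preimage_bigcup.
apply: measure_semi_sigma_additive.
- by move=> k; exact: mcons.
- apply/trivIsetP => /= i j _ _ ij; rewrite -preimage_setI.
  by move/trivIsetP : tF => /(_ _ _ _ _ ij) ->//; rewrite preimage_set0.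
- by rewrite -preimage_bigcup; exact: mcons.
Qed.

HB.instance Definition _ := isMeasure.Build _ _ _ lebesgue_cons
  lebesgue_cons0 lebesgue_cons_ge0 lebesgue_cons_sigma_additive.

Let lebesgue_cons_sigma_finite : sigma_finite setT lebesgue_cons.
Proof.
have /sigma_finiteP[F [TF ndF Foo]] := sigma_finiteT (@lebesgue_measure R).
have /sigma_finiteP[G [TG ndG Goo]] := sigma_finiteT mu.
exists (fun k => @rV_uncons n @^-1` (F k `*` G k)).
  rewrite -preimage_bigcup (_ : \bigcup_k _ = setT) ?preimage_setT//.
  apply/seteqP; split=> // -[x v] _.
  have : setT x by []. rewrite TF => -[i _ Fx].
  have : setT v by []. rewrite TG => -[j _ Gv].
  exists (maxn i j) => //; split=> /=.
  - by move: x Fx; exact/subsetPset/ndF/leq_maxl.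
  - by move: v Gv; exact/subsetPset/ndG/leq_maxr.
move=> k; have [mF Fk] := Foo k; have [mG Gk] := Goo k; split.
  rewrite -[X in measurable X]setTI; apply: measurable_rV_uncons => //.
  exact: measurableX.
rewrite /lebesgue_cons /pushforward (_ : _ @^-1` _ = F k `*` G k).
  by rewrite product_measure1E// lte_mul_pinfty// ge0_fin_numE.
by rewrite -comp_preimage (_ : _ \o _ = id)//; apply: funext; exact: rV_consK.
Qed.

HB.instance Definition _ := Measure_isSigmaFinite.Build _ _ _ lebesgue_cons
  lebesgue_cons_sigma_finite.

End lebesgue_cons.

(* [1 + n] is convertible to [n.+1]. *)
Fixpoint lebesgue_rV n : {sigma_finite_measure set 'rV[R]_n -> \bar R} :=
  if n is n'.+1 then lebesgue_cons (lebesgue_rV n') else \d_(0 : 'rV[R]_0).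

Lemma lebesgue_rV_box n (A : 'I_n -> set (measurableTypeR R)) :
  (forall i, measurable (A i)) ->
  lebesgue_rV n [set v | forall i, A i (v ord0 i)]
  = (\prod_(i < n) (@lebesgue_measure R) (A i))%E.
Proof.
elim: n A => [|n IHn] A mA.
  by rewrite big_ord0 /= diracE mem_set// => -[].
have mB : measurable [set v : 'rV[R]_n | forall i, A (lift ord0 i) (v ord0 i)].
  rewrite (_ : [set v | _] = \bigcap_(i in [set: 'I_n])
     ((fun v : 'rV[R]_n => v ord0 i) @^-1` A (lift ord0 i))); last first.
    by apply/seteqP; split=> [v Av i _|v Av i]; [exact: Av|exact: (Av i)].
  apply: fin_bigcap_measurable => // i _.
  by rewrite -[X in measurable X]setTI; apply: measurable_coord => //; exact: mA.
rewrite big_ord_recl -IHn => [|i]; last exact: mA.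
rewrite -product_measure1E//; congr ((_ \x _)%E _).
have i0 : lshift n (ord0 : 'I_1) = ord0 :> 'I_n.+1 by exact: val_inj.
have iS (j : 'I_n) : rshift 1 j = lift ord0 j :> 'I_n.+1 by exact: val_inj.
have c0 x v : @rV_cons n (x, v) ord0 ord0 = x.
  by rewrite -i0 /rV_cons row_mxEl mxE eqxx mulr1n.
have cS x v j : @rV_cons n (x, v) ord0 (lift ord0 j) = v ord0 j.
  by rewrite -iS /rV_cons row_mxEr.
apply/seteqP; split=> [[x v] /= Axv|[x v] /= [Ax Av] i].
  by split=> [|i]; [rewrite -(c0 x v)|rewrite -(cS x v)]; exact: Axv.
case: (unliftP ord0 i) => [j|] ->; first by rewrite cS.
by rewrite c0.
Qed.

End lebesgue_rV.

Section complex_analysis.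
Context {R : realType}.

Definition cexp (z : R[i]) : R[i] :=
  (expR (complex.Re z))%:C * (cos (complex.Im z) +i* sin (complex.Im z)).

Definition expi (t : R) : R[i] := cexp (0 +i* t).

Definition cintegral n (D : set 'rV[R]_n) (f : 'rV[R]_n -> R[i]) : R[i] :=
  (\int[lebesgue_rV n]_(x in D) complex.Re (f x))
  +i* (\int[lebesgue_rV n]_(x in D) complex.Im (f x)).

(* Sum of a summable real family over a countable index set, as the
   difference of the sums of its positive and negative parts. *)
Definition rsum (I : choiceType) (a : I -> R) : R :=
  fine (\esum_(k in [set: I]) (Num.max (a k) 0)%:E
        - \esum_(k in [set: I]) (Num.max (- a k) 0)%:E)%E.

Definition csum (I : choiceType) (a : I -> R[i]) : R[i] :=
  rsum (fun k => complex.Re (a k)) +i* rsum (fun k => complex.Im (a k)).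

(* [pderive [:: i1; ..; ir] f] is the iterated partial derivative
   d_i1 .. d_ir f. *)
Fixpoint pderive d (s : seq 'I_d) (f : 'rV[R]_d -> R) : 'rV[R]_d -> R :=
  if s is i :: s' then fun x => 'D_(delta_mx ord0 i) (pderive s' f) x else f.

Definition smooth d (f : 'rV[R]_d -> R) : Prop :=
  forall s : seq 'I_d, continuous (pderive s f) /\
    forall (i : 'I_d) x, derivable (pderive s f) x (delta_mx ord0 i).

Definition csmooth d (f : 'rV[R]_d -> R[i]) : Prop :=
  smooth (fun x => complex.Re (f x)) /\ smooth (fun x => complex.Im (f x)).

Definition dotr n (x y : 'rV[R]_n) : R := \sum_i x ord0 i * y ord0 i.

Definition zrow n (k : 'rV[int]_n) : 'rV[R]_n := map_mx intr k.

Definition spaceG n (g : 'rV[R]_n -> 'rV[R]_n -> R[i]) : Prop :=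
  [/\ csmooth (fun z : 'rV[R]_(n + n) => g (lsubmx z) (rsubmx z)),
      forall (k : 'rV[int]_n) x xi, g x (xi + (2 * pi) *: zrow k) = g x xi
    & forall (k : 'rV[int]_n) x xi,
        g (x + (2 * pi) *: zrow k) xi = expi (- dotr (zrow k) xi) * g x xi].

(* The fundamental cube of the torus R^n / (2 pi Z)^n. *)
Definition cube n : set 'rV[R]_n :=
  [set x | forall i, 0 <= x ord0 i <= 2 * pi].
Arguments cube n : clear implicits.

Definition quadform m n (S : 'M[R[i]]_(m + n))
    (x : 'rV[R]_m) (y : 'rV[R]_n) : R[i] :=
  let z := map_mx (real_complex R) (row_mx x y) in
  2^-1 * (z *m S *m z^T) ord0 ord0.

Definition gauss_op m n (S : 'M[R[i]]_(m + n)) (f : 'rV[R]_n -> R[i])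
    (x : 'rV[R]_m) : R[i] :=
  ((2 * pi) `^ (- ((m + n)%:R / 4)))%:C
  * cintegral setT (fun y => cexp (quadform S x y) * f y).

Definition zak n (f : 'rV[R]_n -> R[i]) (x xi : 'rV[R]_n) : R[i] :=
  csum (fun k : 'rV[int]_n =>
    f (x + (2 * pi) *: zrow k) * expi (dotr (zrow k) xi)).

Definition zak_inv n (g : 'rV[R]_n -> 'rV[R]_n -> R[i]) (x : 'rV[R]_n) : R[i] :=
  ((2 * pi) ^- n)%:C * cintegral (cube n) (g x).

Definition theta_kernel m n (S : 'M[R[i]]_(m + n))
    (x xi : 'rV[R]_m) (y eta : 'rV[R]_n) : R[i] :=
  csum (fun k : 'rV[int]_m => csum (fun l : 'rV[int]_n =>
    cexp (quadform S (x + (2 * pi) *: zrow k) (y + (2 * pi) *: zrow l))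
    * expi (dotr (zrow k) xi) * expi (- dotr (zrow l) eta))).

(* The integration variable (y, eta) is encoded as z = row_mx y eta. *)
Definition theta_op m n (S : 'M[R[i]]_(m + n))
    (g : 'rV[R]_n -> 'rV[R]_n -> R[i]) (x xi : 'rV[R]_m) : R[i] :=
  ((2 * pi) `^ (- (3 * (n + m)%:R / 4)))%:C
  * cintegral (cube (n + n)) (fun z =>
      theta_kernel S x xi (lsubmx z) (rsubmx z) * g (lsubmx z) (rsubmx z)).

Definition negative_definite d (A : 'M[R]_d) : Prop :=
  forall v : 'rV[R]_d, v != 0 -> (v *m A *m v^T) ord0 ord0 < 0.

End complex_analysis.

(* Main.v *)
Require Import Defs.
From HB Require Import structures.
From mathcomp Require Import all_boot all_order all_algebra.
From mathcomp Require Import all_classical all_reals all_analysis.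
From mathcomp Require Import measurable_realfun.
From mathcomp Require Import complex ring lra.

(** Write [E k l y] for the Gaussian kernel [exp b(x + 2 pi k, y + 2 pi l)].
    The Gauss operator applied to the inverse Zak transform of [g] integrates
    [exp b(x + 2 pi k, y)] against the integral of [g y eta] over [eta] in the
    fundamental cube, for [y] in the whole of [R^n].  The cubes [Q + 2 pi l]
    tile [R^n], so this integral unfolds into a sum over [l] of integrals over
    [Q]; and the quasi-periodicity of [g] in its first variable turns
    [g (y + 2 pi l) eta] into [e^(- i l.eta) g y eta].  The outcome is

      sum_k e^(i k.xi) sum_l
        int_(Q x Q) E k l y e^(- i l.eta) g y eta dy deta,

    which is also what comes out of the theta-operator when the two lattice
    sums of its kernel are taken out of the integral.  Both sides are thus
    brought to the numbers [torus_coef k l]: the left one by [unfold_gauss],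
    the right one by [cint_theta_kernel]; the powers of [2 pi] are compared in
    [theta_normalisation].

    All exchanges are instances of Fubini's theorem, once a sum over a
    countable type is read as an integral against the counting measure
    ([csum_counting]).  They are licensed by a single domination.  A negative
    definite real part bounds [Re b] by [- c (|x|^2 + |y|^2)]
    ([negative_definite_le], by compactness of the sphere); as
    [t^2 >= 2 |t| - 1], a Gaussian decays at least geometrically along the
    lattice, uniformly in [y] over the cube, so that [|E k l y| <= A k * B l]
    with [A] and [B] summable ([gaussian_kernel_weight]); and [g], being
    continuous, is bounded on the compact cube.

    The measure theory behind the unfolding is that Lebesgue measure on [R^n],
    built by iterated products, is invariant under translations
    ([lebesgue_rV_translation]) and splits along the concatenation of rows
    ([lebesgue_rV_row_mx]), both by induction on the dimension. *)

Set Implicit Arguments.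
Unset Strict Implicit.
Unset Printing Implicit Defensive.

Import Order.TTheory GRing.Theory Num.Theory.
Import numFieldNormedType.Exports.
Local Notation normc := ComplexField.Normc.normc.
Local Notation normcM := ComplexField.Normc.normcM.
Local Open Scope classical_set_scope.
Local Open Scope complex_scope.
Local Open Scope ring_scope.

(** * Complex-valued integrals and Fubini's theorem *)

Section complex_arithmetic.
Context {R : realType}.
Implicit Types (z w : R[i]).

Lemma ReM z w : complex.Re (z * w) =
  complex.Re z * complex.Re w - complex.Im z * complex.Im w.
Proof. by case: z w => [a b] [c d]. Qed.

Lemma ImM z w : complex.Im (z * w) =
  complex.Re z * complex.Im w + complex.Im z * complex.Re w.
Proof. by case: z w => [a b] [c d] /=. Qed.

Lemma normc_ge0 z : 0 <= normc z.
Proof. by case: z => a b; exact: sqrtr_ge0. Qed.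

Lemma normRe_le z : `|complex.Re z| <= normc z.
Proof. by case: z => a b; rewrite -sqrtr_sqr /= ler_wsqrtr// lerDl sqr_ge0. Qed.

Lemma normIm_le z : `|complex.Im z| <= normc z.
Proof. by case: z => a b; rewrite -sqrtr_sqr /= ler_wsqrtr// lerDr sqr_ge0. Qed.

Lemma normc_le_ReIm z : normc z <= `|complex.Re z| + `|complex.Im z|.
Proof.
case: z => a b /=; rewrite -[leRHS]ger0_norm ?addr_ge0// -sqrtr_sqr.
rewrite ler_wsqrtr// sqrrD !real_normK ?num_real// lerD2r lerDl.
by rewrite mulrn_wge0 // mulr_ge0.
Qed.

Lemma normc_real (r : R) : normc r%:C = `|r|.
Proof. by rewrite /= expr0n /= addr0 sqrtr_sqr. Qed.

Lemma normc_cexp z : normc (cexp z) = expR (complex.Re z).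
Proof.
by rewrite /cexp normcM normc_real /= cos2Dsin2 sqrtr1 mulr1 ger0_norm ?expR_ge0.
Qed.

Lemma normc_expi (t : R) : normc (expi t) = 1.
Proof. by rewrite /expi normc_cexp /= expR0. Qed.

End complex_arithmetic.

Section complex_measurable.
Context {R : realType} d (T : measurableType d).
Implicit Types (f g : T -> R[i]).

Definition cmeasurable f :=
  measurable_fun setT (fun x => complex.Re (f x)) /\
  measurable_fun setT (fun x => complex.Im (f x)).

Lemma cmeasurable_cst (c : R[i]) : cmeasurable (fun=> c).
Proof. by split; exact: measurable_cst. Qed.

Lemma cmeasurable_real (h : T -> R) :
  measurable_fun setT h -> cmeasurable (fun x => (h x)%:C).
Proof. by move=> mh; split => //=; exact: measurable_cst. Qed.

Lemma cmeasurableM f g :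
  cmeasurable f -> cmeasurable g -> cmeasurable (fun x => f x * g x).
Proof.
move=> [fr fi] [gr gi]; split.
  under eq_fun do rewrite ReM.
  by apply: measurable_funB; apply: measurable_funM.
under eq_fun do rewrite ImM.
by apply: measurable_funD; apply: measurable_funM.
Qed.

Lemma cmeasurable_sum I (s : seq I) (f : I -> T -> R[i]) :
  (forall i, cmeasurable (f i)) -> cmeasurable (fun x => \sum_(i <- s) f i x).
Proof.
move=> mf; elim: s => [|i s [IHr IHi]].
  under eq_fun do rewrite big_nil; exact: cmeasurable_cst.
have [fr fi] := mf i; split.
  rewrite (_ : (fun _ => _) = (fun x => complex.Re (f i x)) \+
      (fun x => complex.Re (\sum_(j <- s) f j x))); first exact: measurable_funD.
  by apply: funext => x; rewrite big_cons /=; case: (f i x) (\sum_(_ <- _) _) => [a b] [].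
rewrite (_ : (fun _ => _) = (fun x => complex.Im (f i x)) \+
    (fun x => complex.Im (\sum_(j <- s) f j x))); first exact: measurable_funD.
by apply: funext => x; rewrite big_cons /=; case: (f i x) (\sum_(_ <- _) _) => [a b] [].
Qed.

Lemma cmeasurable_cexp f : cmeasurable f -> cmeasurable (fun x => cexp (f x)).
Proof.
move=> [fr fi]; apply: cmeasurableM.
  by apply: cmeasurable_real; exact: (measurableT_comp (@measurable_expR R)).
split => /=.
- apply: (measurableT_comp (f := cos)) => //.
  exact: continuous_measurable_fun (@continuous_cos R).
- apply: (measurableT_comp (f := sin)) => //.
  exact: continuous_measurable_fun (@continuous_sin R).
Qed.

End complex_measurable.

Lemma cmeasurableT_comp (R : realType) d d' (T : measurableType d)
    (T' : measurableType d') (f : T' -> R[i]) (phi : T -> T') :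
  cmeasurable f -> measurable_fun setT phi -> cmeasurable (fun x => f (phi x)).
Proof.
move=> [fr fi] mphi; split.
- exact: (measurableT_comp fr).
- exact: (measurableT_comp fi).
Qed.

Section complex_integral.
Context {R : realType} d (T : measurableType d).
Variable mu : {measure set T -> \bar R}.
Implicit Types (f g : T -> R[i]).

(** This is [cintegral] over the whole space, for an arbitrary measure: with the
    counting measure it also covers [csum], so that every exchange below is
    a case of Fubini's theorem for [cint]. *)
Definition cint f : R[i] :=
  (\int[mu]_x complex.Re (f x)) +i* (\int[mu]_x complex.Im (f x)).

Definition cintegrable f :=
  mu.-integrable setT (fun x => (complex.Re (f x))%:E) /\
  mu.-integrable setT (fun x => (complex.Im (f x))%:E).

Lemma le_cintegrable f (h : T -> R) : cmeasurable f ->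
  mu.-integrable setT (EFin \o h) -> (forall x, normc (f x) <= h x) ->
  cintegrable f.
Proof.
move=> [fr fi] ih fh; split; apply: (le_integrable _ _ _ ih) => //.
- exact/measurable_EFinP.
- move=> x _ /=; rewrite lee_fin (le_trans (normRe_le _))//.
  by rewrite (le_trans (fh x))// ler_norm.
- exact/measurable_EFinP.
- move=> x _ /=; rewrite lee_fin (le_trans (normIm_le _))//.
  by rewrite (le_trans (fh x))// ler_norm.
Qed.

Lemma cintZ c f : cintegrable f -> cint (fun x => c * f x) = c * cint f.
Proof.
move=> [fr fi].
have Zr a := RintegralZl a measurableT fr; have Zi a := RintegralZl a measurableT fi.
have ir a : mu.-integrable setT (EFin \o (fun x => a * complex.Re (f x))).
  exact: (integrableZl measurableT a fr).
have ii a : mu.-integrable setT (EFin \o (fun x => a * complex.Im (f x))).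
  exact: (integrableZl measurableT a fi).
apply/eqP; rewrite eq_complex ReM ImM /= -!Zr -!Zi; apply/andP; split; apply/eqP.
  by rewrite -RintegralB//; apply: eq_Rintegral => x _; rewrite ReM.
by rewrite -RintegralD//; apply: eq_Rintegral => x _; rewrite ImM.
Qed.

(** The factor [2] comes from bounding the real and imaginary parts separately. *)
Lemma normc_cint_le f (h : T -> R) : cmeasurable f ->
  mu.-integrable setT (EFin \o h) -> (forall x, normc (f x) <= h x) ->
  normc (cint f) <= 2 * \int[mu]_x h x.
Proof.
move=> mf ih fh; have [ir ii] := le_cintegrable mf ih fh.
rewrite mulr_natl mulr2n (le_trans (normc_le_ReIm _))//=.
apply: lerD; apply: (le_trans (le_normr_Rintegral _ _)) => //; apply: le_Rintegral => //.
- exact: integrable_norm ir.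
- by move=> x _; exact: (le_trans (normRe_le _)).
- exact: integrable_norm ii.
- by move=> x _; exact: (le_trans (normIm_le _)).
Qed.

Lemma eq_cint f g : f =1 g -> cint f = cint g.
Proof. by move=> fg; congr cint; exact: funext. Qed.

Lemma cint0 : cint (fun=> 0) = 0.
Proof. by rewrite /cint /Rintegral !integral0. Qed.

End complex_integral.

Section complex_fubini.
Context {R : realType} d1 d2 (T1 : measurableType d1) (T2 : measurableType d2).
Variable m1 : {sigma_finite_measure set T1 -> \bar R}.
Variable m2 : {sigma_finite_measure set T2 -> \bar R}.
Implicit Type f : T1 * T2 -> R[i].

(** Positive and negative parts are integrated separately, so that this applies
    to [g] on the product of [R^n] and the cube, where it is bounded but in
    general not integrable; it makes [zak_inv g] measurable on the whole space. *)
Lemma measurable_Rintegral_fst (f : T1 * T2 -> R) : measurable_fun setT f ->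
  measurable_fun setT (fun x => \int[m2]_y f (x, y)).
Proof.
move=> mf; apply: measurableT_comp => //.
under eq_fun do rewrite integralE.
have mEf : measurable_fun setT (EFin \o f) by exact/measurable_EFinP.
apply: emeasurable_funB.
- rewrite (_ : (fun _ => _) = fubini_F m2 (EFin \o f)^\+%E).
    exact: (measurable_fun_fubini_tonelli_F _ (measurable_funepos mEf)).
  by apply: funext => x; apply: eq_integral => y _; rewrite !funeposE.
- rewrite (_ : (fun _ => _) = fubini_F m2 (EFin \o f)^\-%E).
    exact: (measurable_fun_fubini_tonelli_F _ (measurable_funeneg mEf)).
  by apply: funext => x; apply: eq_integral => y _; rewrite !funenegE.
Qed.

Lemma cmeasurable_cint f : cmeasurable f ->
  cmeasurable (fun x => cint m2 (fun y => f (x, y))).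
Proof. by move=> [fr fi]; split; exact: (measurable_Rintegral_fst (f := _ \o f)). Qed.

(** A bound in product form makes every section of the integrand integrable, not
    just almost every one; so both iterated integrals, which take the real
    value [0] at a divergent inner integral, equal the double integral with no
    exceptional set. *)
Variables (A : T1 -> R) (B : T2 -> R).
Hypotheses (A0 : forall x, 0 <= A x) (B0 : forall y, 0 <= B y).
Hypotheses (iA : m1.-integrable setT (EFin \o A))
  (iB : m2.-integrable setT (EFin \o B)).

Lemma integrable_tensor :
  (m1 \x m2)%E.-integrable setT (EFin \o (fun z : T1 * T2 => A z.1 * B z.2)).
Proof.
have mA : measurable_fun setT A by exact/measurable_EFinP/(measurable_int _ iA).
have mB : measurable_fun setT B by exact/measurable_EFinP/(measurable_int _ iB).
apply/integrable12ltyP => /=.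
  apply/measurable_EFinP/measurable_funM.
  - exact: (measurableT_comp mA).
  - exact: (measurableT_comp mB).
under eq_integral => x _.
  under eq_integral => y _ do rewrite ger0_norm ?mulr_ge0// EFinM.
  rewrite integralZl//=; over.
rewrite /= -(fineK (integrable_fin_num _ iB))// integralZr// lte_mul_pinfty//.
- by apply: integral_ge0 => x _; rewrite lee_fin.
- exact: integrable_fin_num iA.
- by rewrite ltry.
Qed.

Variable f : T1 * T2 -> R[i].
Hypotheses (mf : cmeasurable f) (fAB : forall x y, normc (f (x, y)) <= A x * B y).

Let if12 : cintegrable (m1 \x m2)%E f.
Proof. by apply: (le_cintegrable mf integrable_tensor) => -[x y]; exact: fAB. Qed.

Lemma cintegrable_snd x : cintegrable m2 (fun y => f (x, y)).
Proof.
apply: (@le_cintegrable _ _ _ _ _ (fun y => A x * B y)) => //.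
  exact: (cmeasurableT_comp mf).
exact: (integrableZl measurableT (A x) iB).
Qed.

Lemma cintegrable_fst y : cintegrable m1 (fun x => f (x, y)).
Proof.
apply: (@le_cintegrable _ _ _ _ _ (fun x => A x * B y)) => //.
  exact: (cmeasurableT_comp mf).
exact: (integrableZr measurableT (B y) iA).
Qed.

Lemma cint_prod12 :
  cint (m1 \x m2)%E f = cint m1 (fun x => cint m2 (fun y => f (x, y))).
Proof.
have [ir ii] := if12.
congr (_ +i* _); rewrite /Rintegral -integral12_prod_meas1//; congr fine;
  apply: eq_integral => x _; have [xr xi] := cintegrable_snd x;
  by rewrite /= /Rintegral fineK//; exact: integrable_fin_num.
Qed.

Lemma cint_prod21 :
  cint (m1 \x m2)%E f = cint m2 (fun y => cint m1 (fun x => f (x, y))).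
Proof.
have [ir ii] := if12.
congr (_ +i* _); rewrite /Rintegral -integral21_prod_meas1//; congr fine;
  apply: eq_integral => y _; have [yr yi] := cintegrable_fst y;
  by rewrite /= /Rintegral fineK//; exact: integrable_fin_num.
Qed.

Lemma cint_swap : cint m1 (fun x => cint m2 (fun y => f (x, y))) =
  cint m2 (fun y => cint m1 (fun x => f (x, y))).
Proof. by rewrite -cint_prod12 cint_prod21. Qed.

End complex_fubini.

(** * Sums over countable types as integrals *)

Section counting_nat.
Variable R : realType.
HB.instance Definition _ := Measure_isSigmaFinite.Build _ _ _
  (@counting nat R) (@sigma_finite_counting R).
End counting_nat.

Section countable_sums.
Context {R : realType} {I : countType}.

(** The family [a], transported to [nat] along the enumeration of [I] and
    extended by [v0] to the integers that enumerate nothing; integrating it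
    over [nat] is summing [a] over [I], whether [I] is finite or not. *)
Definition pickled {V : Type} (v0 : V) (a : I -> V) (k : nat) : V :=
  oapp a v0 (pickle_inv k).

Lemma esum_counting (a : I -> \bar R) : (forall i, (0 <= a i)%E) ->
  (\esum_(i in [set: I]) a i = \int[counting]_k pickled 0%E a k)%E.
Proof.
move=> a0; have p0 k : (0 <= pickled 0%E a k)%E.
  by rewrite /pickled; case: pickle_inv => /=.
rewrite ge0_integral_count// nneseries_esumT//.
transitivity (\esum_(k in range (@pickle I)) pickled 0%E a k)%E.
  rewrite (@reindex_esum _ _ _ setT (range (@pickle I)) (@pickle I)).
    by apply: eq_esum => i _; rewrite /pickled pickleK_inv.
  by split.
rewrite esum_mkcond; apply: eq_esum => k _; case: ifPn => // /negP; rewrite inE /pickled.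
by have := @pickle_invK I k; case: pickle_inv => //= i <- []; exists i.
Qed.

(** Both sides are differences of the sums of the positive and negative parts, so
    that the identity covers divergent families too. *)
Lemma rsum_counting (a : I -> R) : rsum a = \int[counting]_k pickled 0 a k.
Proof.
rewrite /rsum /Rintegral integralE !esum_counting; last 2 first.
- by move=> i; rewrite lee_fin le_max lexx orbT.
- by move=> i; rewrite lee_fin le_max lexx orbT.
congr (fine (_ - _)%E); apply: eq_integral => k _; rewrite ?funeposE ?funenegE /pickled.
- by case: pickle_inv => [i|] /=; [rewrite EFin_max|exact/esym/maxxx].
- by case: pickle_inv => [i|] /=; [rewrite EFin_max|rewrite oppr0; exact/esym/maxxx].
Qed.

Lemma csum_counting (a : I -> R[i]) : csum a = cint counting (pickled 0 a).
Proof.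
rewrite /csum !rsum_counting; congr (_ +i* _); apply: eq_Rintegral => k _;
  by rewrite /pickled; case: pickle_inv.
Qed.

Definition weight (A : I -> R) :=
  (forall i, 0 <= A i) /\ (\esum_(i in [set: I]) (A i)%:E < +oo)%E.

Lemma esumZl (a : I -> \bar R) (r : R) : (0 <= r)%R -> (forall i, (0 <= a i)%E) ->
  (\esum_(i in [set: I]) (r%:E * a i) = r%:E * \esum_(i in [set: I]) a i)%E.
Proof.
move=> r0 a0; rewrite !esum_counting//; last by move=> i; rewrite mule_ge0.
rewrite -ge0_integralZl//; last by move=> k _; rewrite /pickled; case: pickle_inv => /=.
by apply: eq_integral => k _; rewrite /pickled; case: pickle_inv => //=; rewrite mule0.
Qed.

Lemma weightZ (r : R) A : 0 <= r -> weight A -> weight (fun i => r * A i).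
Proof.
move=> r0 [A0 Aoo]; split => [i|]; first exact: mulr_ge0.
under eq_esum do rewrite EFinM.
rewrite esumZl//.
by rewrite lte_mul_pinfty// lee_fin.
Qed.

Lemma le_weight A B : (forall i, 0 <= A i <= B i) -> weight B -> weight A.
Proof.
move=> AB [B0 Boo]; split => [i|]; first by have /andP[] := AB i.
apply: le_lt_trans Boo; apply: le_esum => i _; rewrite lee_fin.
by have /andP[] := AB i.
Qed.

Lemma weight_pickled_ge0 A : weight A -> forall k, 0 <= pickled 0 A k.
Proof. by move=> [A0 _] k; rewrite /pickled; case: pickle_inv => /=. Qed.

Lemma weight_integrable A : weight A ->
  (@counting _ R).-integrable setT (EFin \o pickled 0 A).
Proof.
move=> wA; have [A0 foo] := wA; apply/integrableP; split => //.
rewrite esum_counting// in foo; apply: le_lt_trans foo; rewrite le_eqVlt.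
apply/orP; left; apply/eqP; apply: eq_integral => k _ /=.
rewrite ger0_norm ?weight_pickled_ge0//.
by rewrite /pickled; case: pickle_inv.
Qed.

Lemma cmeasurable_nat (f : nat -> R[i]) : cmeasurable f.
Proof. by split. Qed.

Lemma pickled_le (a : I -> R[i]) A : (forall i, normc (a i) <= A i) ->
  forall k, normc (pickled 0 a k) <= pickled 0 A k.
Proof.
move=> aA k; rewrite /pickled; case: pickle_inv => //=.
by rewrite expr0n/= addr0 sqrtr0.
Qed.

Lemma csumZ c (a : I -> R[i]) A : weight A -> (forall i, normc (a i) <= A i) ->
  csum (fun i => c * a i) = c * csum a.
Proof.
move=> wA aA; rewrite !csum_counting -cintZ.
  by apply: eq_cint => k; rewrite /pickled; case: pickle_inv => //=; rewrite mulr0.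
apply: (le_cintegrable (cmeasurable_nat _) (weight_integrable wA)).
exact: pickled_le.
Qed.

Lemma normc_csum_le (a : I -> R[i]) A : weight A -> (forall i, normc (a i) <= A i) ->
  normc (csum a) <= 2 * rsum A.
Proof.
move=> wA aA; rewrite csum_counting rsum_counting.
apply: normc_cint_le => //.
- exact: weight_integrable.
- exact: pickled_le.
Qed.

(** [rsum] splits a family into its positive and negative parts; the point here is
    that any other splitting into summable nonnegative families will do. *)
Lemma rsumB (p q : I -> R) : weight p -> weight q ->
  rsum (fun i => p i - q i) = rsum p - rsum q.
Proof.
move=> wp wq; rewrite !rsum_counting -RintegralB//; try exact: weight_integrable.
by apply: eq_Rintegral => k _; rewrite /pickled; case: pickle_inv => //=; rewrite subr0.
Qed.

Lemma rsumE (p : I -> R) : weight p ->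
  rsum p = fine (\esum_(i in [set: I]) (p i)%:E)%E.
Proof.
move=> wp; rewrite rsum_counting esum_counting; last by move=> i; rewrite lee_fin wp.1.
by congr fine; apply: eq_integral => k _; rewrite /pickled; case: pickle_inv.
Qed.

Lemma rsumZ (r : R) (p : I -> R) : 0 <= r -> weight p ->
  rsum (fun i => r * p i) = r * rsum p.
Proof.
move=> r0 wp; rewrite (rsumE (weightZ r0 wp)) (rsumE wp).
under eq_esum do rewrite EFinM.
rewrite esumZl//; last by move=> i; rewrite lee_fin wp.1.
rewrite fineM// ge0_fin_numE ?wp.2//.
by apply: esum_ge0 => i _; rewrite lee_fin wp.1.
Qed.

Lemma csum0 : csum (fun _ : I => 0) = 0 :> R[i].
Proof.
rewrite csum_counting -[RHS](@cint0 _ _ _ (@counting nat R)).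
by apply: eq_cint => k; rewrite /pickled; case: pickle_inv.
Qed.

Lemma eq_csum (a b : I -> R[i]) : a =1 b -> csum a = csum b.
Proof. by move=> ab; congr csum; exact: funext. Qed.

Section with_parameter.
Context d (T : measurableType d).

Lemma measurable_prod_nat d' (T' : measurableType d') (f : T * nat -> T') :
  (forall k, measurable_fun setT (fun y => f (y, k))) -> measurable_fun setT f.
Proof.
move=> mf _ Y mY; rewrite setTI.
rewrite (_ : _ @^-1` _ = \bigcup_k (((fun y => f (y, k)) @^-1` Y) `*` [set k])).
  apply: bigcupT_measurable => k; apply: measurableX => //.
  by rewrite -[X in measurable X]setTI; exact: mf.
apply/seteqP; split => [[y k] /= fY|[y k] [j _] [/= fY ->]//].
by exists k.
Qed.

Lemma cmeasurable_pickled (f : I -> T -> R[i]) : (forall i, cmeasurable (f i)) ->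
  cmeasurable (fun z : T * nat => pickled 0 (f^~ z.1) z.2).
Proof.
move=> mf; split; apply: measurable_prod_nat => k; rewrite /pickled /=;
  case: pickle_inv => [i|] /=; [exact: (mf i).1|exact: measurable_cst|
    exact: (mf i).2|exact: measurable_cst].
Qed.

Lemma cmeasurable_csum (f : I -> T -> R[i]) : (forall i, cmeasurable (f i)) ->
  cmeasurable (fun y => csum (f^~ y)).
Proof.
move=> mf; under eq_fun do rewrite csum_counting.
exact: (cmeasurable_cint (@counting nat R) (cmeasurable_pickled mf)).
Qed.

(** Fubini's theorem for [mu] and the counting measure. *)
Lemma cint_csum (mu : {sigma_finite_measure set T -> \bar R})
    (f : I -> T -> R[i]) (A : I -> R) (B : T -> R) :
  (forall i, cmeasurable (f i)) -> weight A ->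
  (forall y, 0 <= B y) -> mu.-integrable setT (EFin \o B) ->
  (forall i y, normc (f i y) <= A i * B y) ->
  cint mu (fun y => csum (f^~ y)) = csum (fun i => cint mu (f i)).
Proof.
move=> mf wA B0 iB fAB.
under eq_cint do rewrite csum_counting.
have -> := @cint_swap _ _ _ _ _ mu (@counting nat R) B (pickled 0 A) B0
  (weight_pickled_ge0 wA) iB (weight_integrable wA) _ (cmeasurable_pickled mf).
  rewrite csum_counting; apply: eq_cint => k; rewrite /pickled /=.
  case: pickle_inv => //=; rewrite /cint /= /Rintegral integral0_eq//.
move=> y k; rewrite mulrC /pickled /=; case: pickle_inv => [i|] //=.
by rewrite expr0n/= addr0 sqrtr0 mul0r.
Qed.

End with_parameter.
End countable_sums.

(** * Lebesgue measure on row vectors: translations, products, tilings *)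

Section lebesgue_rV_product.
Context {R : realType}.

Lemma lebesgue_measure_translation (a : R) (A : set (measurableTypeR R)) :
  measurable A -> lebesgue_measure ((fun x => x + a) @^-1` A) = lebesgue_measure A.
Proof.
have mt : measurable_fun [set: measurableTypeR R]
    (fun x => x + a : measurableTypeR R).
  by apply: measurable_funD => //; exact: measurable_cst.
move=> mA; symmetry; apply: (@lebesgue_measure_unique R
  (pushforward lebesgue_measure (fun x : measurableTypeR R => x + a : measurableTypeR R))) => //.
move=> _ [[b c] _ <-]; rewrite /= /pushforward.
rewrite (_ : _ @^-1` _ = `]b - a, c - a]%classic); last first.
  by apply/seteqP; split => x /=; rewrite !in_itv /= ltrBlDr lerBrDr.
by rewrite !lebesgue_measure_itv /= !lte_fin ltrD2r -!EFinB opprB addrA subrK.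
Qed.

Lemma preimage_measurable d d' (T : measurableType d) (T' : measurableType d')
    (f : T -> T') (A : set T') :
  measurable_fun setT f -> measurable A -> measurable (f @^-1` A).
Proof. by move=> mf mA; rewrite -[X in measurable X]setTI; exact: mf. Qed.

Lemma measurable_rV_add n (w : 'rV[R]_n) : measurable_fun setT (fun v : 'rV[R]_n => v + w).
Proof.
apply: measurable_fun_rVP => i.
under eq_fun do rewrite mxE.
by apply: measurable_funD => //; exact: measurable_coord.
Qed.

Lemma measurable_row_mx p q :
  measurable_fun setT (fun z : 'rV[R]_p * 'rV[R]_q => row_mx z.1 z.2).
Proof.
apply: measurable_fun_rVP => i; case: (split_ordP i) => j ->.
- under eq_fun do rewrite row_mxEl.
  exact: (measurableT_comp (measurable_coord j) measurable_fst).
- under eq_fun do rewrite row_mxEr.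
  exact: (measurableT_comp (measurable_coord j) measurable_snd).
Qed.

Lemma measurable_lsubmx p q :
  measurable_fun setT (fun z : 'rV[R]_(p + q) => lsubmx z).
Proof.
apply: measurable_fun_rVP => i; under eq_fun do rewrite mxE; exact: measurable_coord.
Qed.

Lemma measurable_rsubmx p q :
  measurable_fun setT (fun z : 'rV[R]_(p + q) => rsubmx z).
Proof.
apply: measurable_fun_rVP => i; under eq_fun do rewrite mxE; exact: measurable_coord.
Qed.

Lemma lebesgue_rVS n (A : set 'rV[R]_(1 + n)) :
  lebesgue_rV n.+1 A =
  (\int[lebesgue_measure]_x lebesgue_rV n [set v | A (@rV_cons R n (x, v))])%E.
Proof.
apply: eq_integral => x _ /=; congr (lebesgue_rV n _).
by apply/seteqP; split => v; rewrite /xsection /= inE.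
Qed.

(** Induction on the dimension: each slice is translated in [R^n], and the slices
    are permuted by a translation of the real line. *)
Lemma lebesgue_rV_translation n (w : 'rV[R]_n) (A : set 'rV[R]_n) :
  measurable A -> lebesgue_rV n ((fun v : 'rV[R]_n => v + w) @^-1` A) = lebesgue_rV n A.
Proof.
elim: n w A => [|n IHn] w A mA.
  by congr (lebesgue_rV 0 _); apply/seteqP; split => v /=; rewrite !thinmx0.
rewrite !lebesgue_rVS.
change 'rV[R]_(1 + n) in w; change (set 'rV[R]_(1 + n)) in A.
pose a := w ord0 (lshift n (ord0 : 'I_1)).
pose h x := lebesgue_rV n [set v | A (@rV_cons R n (x, v))].
have mC := preimage_measurable (@measurable_rV_cons R n) mA.
have mh : measurable_fun [set: measurableTypeR R] h.
  rewrite (_ : h = lebesgue_rV n \o xsection ((@rV_cons R n) @^-1` A)).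
    exact: measurable_fun_xsection.
  by apply: funext => x /=; congr (lebesgue_rV n _); apply/seteqP; split => v;
    rewrite /xsection /= inE.
pose t (x : measurableTypeR R) : measurableTypeR R := x + a.
transitivity (\int[lebesgue_measure]_x h (t x))%E.
  apply: eq_integral => x _; rewrite /h -[RHS](IHn (rsubmx w)); last first.
    apply: (preimage_measurable (f := @rV_cons R n \o pair (t x)) _ mA).
    by apply: measurableT_comp; [exact: measurable_rV_cons|exact: measurable_pair1].
  congr (lebesgue_rV n _); apply/seteqP.
  have -> : (fun v => A (rV_cons (x, v) + w)) =
      (fun v => A (rV_cons (t x, v + rsubmx w))).
    apply: funext => v; congr (A _).
    rewrite -[w in LHS]hsubmxK /rV_cons add_row_mx /=; congr row_mx.
    by apply/rowP => i; rewrite !mxE !ord1 eqxx !mulr1n /a.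
  by split.
have mt : measurable_fun setT t.
  by apply: measurable_funD => //; exact: measurable_cst.
rewrite -[LHS](ge0_integral_pushforward mt lebesgue_measure (D := setT) (f := h))//.
by apply: eq_measure_integral => B mB _; exact: lebesgue_measure_translation.
Qed.

(** Associativity of concatenation, in the form needed for the induction below:
    no cast appears because [1 + (p + q)] and [1 + p + q] are convertible. *)
Lemma rV_cons_row_mx p q (x : R) (y : 'rV[R]_p) (w : 'rV[R]_q) :
  @rV_cons R (p + q) (x, row_mx y w) = row_mx (@rV_cons R p (x, y)) w.
Proof.
have := @row_mxA _ 1 1 p q (x%:M) y w; rewrite /= castmx_id; exact.
Qed.

(** Induction on [p], peeling off the first coordinate; the induction step is
    Tonelli's theorem for the first coordinate against the remaining [p]. *)
Lemma lebesgue_rV_row_mx p q (A : set 'rV[R]_(p + q)) : measurable A ->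
  lebesgue_rV (p + q) A =
  (lebesgue_rV p \x lebesgue_rV q)%E
    ((fun z : 'rV[R]_p * 'rV[R]_q => row_mx z.1 z.2) @^-1` A).
Proof.
move=> mA; rewrite [RHS](_ : _ =
    \int[lebesgue_rV p]_y lebesgue_rV q [set w | A (row_mx y w)])%E; last first.
  apply: eq_integral => x _ /=; congr (lebesgue_rV q _).
  by apply/seteqP; split => v; rewrite /xsection /= inE.
have slice_measurable p' (B : set 'rV[R]_(p' + q)) : measurable B ->
    measurable_fun setT (fun y => lebesgue_rV q [set w | B (row_mx y w)]).
  move=> mB; rewrite (_ : (fun _ => _) = lebesgue_rV q \o
      xsection ((fun z : 'rV[R]_p' * 'rV[R]_q => row_mx z.1 z.2) @^-1` B)).
    apply: measurable_fun_xsection.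
    exact: (preimage_measurable (@measurable_row_mx p' q)).
  by apply: funext => y /=; congr (lebesgue_rV q _); apply/seteqP; split => v;
    rewrite /xsection /= inE.
elim: p A mA => [|p IHp] A mA.
  rewrite [RHS]integral_dirac//; last exact: slice_measurable.
  rewrite diracT mul1e; congr (lebesgue_rV q _).
  by apply/seteqP; split => v /=; rewrite row_thin_mx.
rewrite (@lebesgue_rVS (p + q)).
pose h (y : 'rV[R]_(1 + p)) := lebesgue_rV q [set w | A (row_mx y w)].
have mh : measurable_fun setT h by exact: slice_measurable.
have mhc : measurable_fun setT (h \o @rV_cons R p).
  exact: (measurableT_comp mh (@measurable_rV_cons R p)).
transitivity (\int[lebesgue_measure]_x \int[lebesgue_rV p]_y h (rV_cons (x, y)))%E.
  apply: eq_integral => x _; rewrite IHp; last first.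
    apply: (preimage_measurable (f := @rV_cons R (p + q) \o pair x) _ mA).
    by apply: measurableT_comp; [exact: measurable_rV_cons|exact: measurable_pair1].
  apply: eq_integral => y _; congr (lebesgue_rV q _).
  apply/seteqP.
  have -> : (fun w => A (rV_cons (x, row_mx y w))) =
      (fun w => A (row_mx (rV_cons (x, y)) w)).
    apply: funext => w; congr (A _).
    exact: rV_cons_row_mx.
  by split.
rewrite -(fubini_tonelli1 (h \o @rV_cons R p))//.
by rewrite -(ge0_integral_pushforward (@measurable_rV_cons R p) _ (D := setT) (f := h)).
Qed.


(** Half-open, so that the cells with a given side [c] partition the space. *)
Definition cell n (c : R) (l : 'rV[int]_n) : set 'rV[R]_n :=
  [set v | forall i, c * (l ord0 i)%:~R <= v ord0 i < c * (l ord0 i)%:~R + c].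

Definition cell_index n (c : R) (v : 'rV[R]_n) : 'rV[int]_n :=
  \row_i Num.floor (v ord0 i / c).

Lemma cellP n (c : R) (l : 'rV[int]_n) v : 0 < c ->
  cell c l v <-> cell_index c v = l.
Proof.
move=> c0; have E i : (c * (l ord0 i)%:~R <= v ord0 i < c * (l ord0 i)%:~R + c) =
    (Num.floor (v ord0 i / c) == l ord0 i).
  rewrite floor_eq intrD ler_pdivlMr// ltr_pdivrMr// mulrDl mul1r.
  by rewrite [_%:~R * c]mulrC.
split => [H|El i]; last by rewrite E -El mxE.
by apply/rowP => i; rewrite mxE; apply/eqP; rewrite -E; exact: H.
Qed.

Lemma measurable_rV_box n (A : 'I_n -> set (measurableTypeR R)) :
  (forall i, measurable (A i)) ->
  measurable [set v : 'rV[R]_n | forall i, A i (v ord0 i)].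
Proof.
move=> mA; rewrite (_ : [set v | _] =
    \bigcap_(i in [set: 'I_n]) ((fun v : 'rV[R]_n => v ord0 i) @^-1` A i)).
  apply: fin_bigcap_measurable => // i _.
  exact: (preimage_measurable (measurable_coord i) (mA i)).
by apply/seteqP; split=> [v Av i _|v Av i]; [exact: Av|exact: (Av i)].
Qed.

Lemma cellE n (c : R) (l : 'rV[int]_n) : cell c l =
  [set v | forall i, `[c * (l ord0 i)%:~R, c * (l ord0 i)%:~R + c[%classic (v ord0 i)].
Proof. by apply/seteqP; split => v H i; have /= := H i; rewrite in_itv. Qed.

Lemma measurable_cell n (c : R) (l : 'rV[int]_n) : measurable (cell c l).
Proof.
rewrite cellE; apply: (@measurable_rV_box n (fun i =>
  `[c * (l ord0 i)%:~R, c * (l ord0 i)%:~R + c[%classic)) => i.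
exact: measurable_itv.
Qed.

Lemma preimage_cell n (c : R) (l : 'rV[int]_n) :
  (fun v : 'rV[R]_n => v + c *: zrow l) @^-1` (cell c l) = cell c 0.
Proof.
by apply/seteqP; split => v H i; have := H i; rewrite !mxE mulr0 add0r;
  rewrite addrC lerDl ltrD2l.
Qed.

Definition closed_cell n (c : R) : set 'rV[R]_n := [set v | forall i, 0 <= v ord0 i <= c].
Arguments closed_cell n c : clear implicits.

Lemma closed_cellE n (c : R) : closed_cell n c =
  [set v | forall i, `[0, c]%classic (v ord0 i)].
Proof. by apply/seteqP; split => v H i; have /= := H i; rewrite in_itv. Qed.

Lemma measurable_closed_cell n (c : R) : measurable (closed_cell n c).
Proof.
rewrite closed_cellE.
by apply: (@measurable_rV_box n (fun=> `[0, c]%classic)) => i; exact: measurable_itv.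
Qed.

Lemma lebesgue_closed_cell n (c : R) : (lebesgue_rV n (closed_cell n c) < +oo)%E.
Proof.
rewrite closed_cellE (@lebesgue_rV_box R n (fun=> `[0, c]%classic)) => [|i]; last exact: measurable_itv.
elim/big_rec : _ => [|i x _ xoo]; first by rewrite ltry.
rewrite lebesgue_measure_itv /= lte_fin; case: ifPn => [c0|_]; last by rewrite mul0e.
rewrite lte_mul_pinfty//.
by rewrite lee_fin oppr0 addr0 ltW.
Qed.

(** The faces by which the two cells differ lie in hyperplanes, which are null. *)
Lemma ge0_integral_closed_cell n (c : R) (f : 'rV[R]_n -> \bar R) :
  measurable_fun setT f -> (forall v, (0 <= f v)%E) ->
  (\int[lebesgue_rV n]_(v in cell c 0) f v =
   \int[lebesgue_rV n]_(v in closed_cell n c) f v)%E.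
Proof.
move=> mf f0.
pose N i : set 'rV[R]_n := [set v | v ord0 i = c].
have NE i : N i = [set v | forall j, (if j == i then [set c] else setT) (v ord0 j)].
  apply/seteqP; split => [v Nv j|v Nv]; first by case: eqP => // ->.
  by have := Nv i; rewrite eqxx.
have mN i : measurable (N i).
  by rewrite NE; apply: (@measurable_rV_box n (fun j => if j == i then [set c] else setT)) => j; case: ifP.
have N0 i : lebesgue_rV n (N i) = 0%E.
  rewrite NE (@lebesgue_rV_box R n (fun j => if j == i then [set c] else setT)).
    by rewrite (bigD1 i)//= eqxx lebesgue_measure_set1 mul0e.
  by move=> j; case: ifP.
pose U := \big[setU/set0]_(i < n) N i.
have [mU U0] : measurable U /\ lebesgue_rV n U = 0%E.
  rewrite /U; elim/big_ind: _ => [|A B [mA A0] [mB B0]|i _]; last by split.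
  - by split; rewrite ?measure0.
  - by split; [exact: measurableU|rewrite measureU0].
rewrite [RHS](@ge0_negligible_integral _ _ _ _ _ U)//.
- congr (integral _ _ _); rewrite /U -bigcup_seq; apply/seteqP; split => v.
    move=> Hv; have Hv' i : 0 <= v ord0 i < c.
      by have := Hv i; rewrite !mxE mulr0 add0r.
    split=> [i|[i _ /=]]; first by have /andP[-> /ltW] := Hv' i.
    by rewrite /N /= => vc; have := Hv' i; rewrite vc ltxx andbF.
  move=> [Hv Nv] i; have /andP[v0 vc] := Hv i; rewrite !mxE mulr0 add0r v0 /=.
  rewrite lt_neqAle vc andbT; apply/eqP => vic; apply: Nv.
  by exists i => //=; rewrite mem_index_enum.
- exact: measurable_closed_cell.
- exact: measurable_funTS.
Qed.

(** The space is the disjoint union of the cells, and translation by [c l] moves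
    each one back to the cell at the origin. *)
Lemma ge0_integral_cells n (c : R) (f : 'rV[R]_n -> \bar R) : 0 < c ->
  measurable_fun setT f -> (forall v, (0 <= f v)%E) ->
  (\int[lebesgue_rV n]_v f v = \esum_(l in [set: 'rV[int]_n])
     \int[lebesgue_rV n]_(v in closed_cell n c) f (v + c *: zrow l)%R)%E.
Proof.
move=> c0 mf f0; rewrite esum_counting; last by move=> l; exact: integral_ge0.
rewrite ge0_integral_count; last first.
  by move=> k; rewrite /pickled; case: pickle_inv => //= l; exact: integral_ge0.
pose F k : set 'rV[R]_n := [set v | pickle (cell_index c v) = k].
have FE k : F k = pickled set0 (cell c) k.
  rewrite /pickled; case E : pickle_inv => [l|] /=.
    have kl : k = pickle l by have := @pickle_invK 'rV[int]_n k; rewrite E.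
    apply/seteqP; split => v; rewrite /F /= kl.
      by move=> /(pcan_inj (@pickleK_inv _)) ?; apply/cellP.
    by move=> /cellP -> .
  apply/seteqP; split => v //; rewrite /F /= => vk.
  by have := @pickleK_inv 'rV[int]_n (cell_index c v); rewrite vk E.
have mF k : measurable (F k).
  by rewrite FE /pickled; case: pickle_inv => //= l; exact: measurable_cell.
have -> : [set: 'rV[R]_n] = \bigcup_k F k.
  by apply/seteqP; split => // v _; exists (pickle (cell_index c v)).
rewrite ge0_integral_bigcup//; last 2 first.
- exact: measurable_funTS.
- by apply/trivIsetP => i j _ _ /eqP ij; apply/seteqP; split => // v [Fi Fj]; case: ij; rewrite -[LHS]Fi -[RHS]Fj.
apply: eq_eseriesr => k _; rewrite FE /pickled; case: pickle_inv => [l|] /=; last first.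
  exact: integral_set0.
have mfl : measurable_fun setT (fun v : 'rV[R]_n => f (v + c *: zrow l)).
  exact: (measurableT_comp mf (measurable_rV_add _)).
rewrite -ge0_integral_closed_cell// -(preimage_cell c l).
rewrite -(ge0_integral_pushforward (measurable_rV_add (c *: zrow l)) _ (f := f))//.
- apply: eq_measure_integral => [|mt B mB _]; first exact: measurable_rV_add.
  exact: esym (lebesgue_rV_translation _ mB).
- exact: measurable_cell.
- exact: measurable_funTS.
Qed.

End lebesgue_rV_product.
Arguments closed_cell {R} n c.
Arguments measurable_closed_cell {R} n c. Arguments lebesgue_closed_cell {R} n c.

(** * Complex integrals over row vectors *)

Section complex_lebesgue.
Context {R : realType}.

Lemma cintegral_indic n (D : set 'rV[R]_n) (f : 'rV[R]_n -> R[i]) :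
  cintegral D f = cint (lebesgue_rV n) (fun v => (\1_D v)%:C * f v).
Proof.
congr (_ +i* _); rewrite Rintegral_mkcond; apply: eq_Rintegral => v _.
- rewrite ReM /patch indicE /= mul0r subr0.
  by case: ifPn => _; rewrite ?mul1r ?mul0r.
- rewrite ImM /patch indicE /= mul0r addr0.
  by case: ifPn => _; rewrite ?mul1r ?mul0r.
Qed.

Lemma cintegralT n (f : 'rV[R]_n -> R[i]) :
  cintegral setT f = cint (lebesgue_rV n) f.
Proof. by []. Qed.

Lemma cmeasurable_indic n (D : set 'rV[R]_n) : measurable D ->
  cmeasurable (fun v => (\1_D v)%:C : R[i]).
Proof. by move=> mD; apply: cmeasurable_real; exact: measurable_indic. Qed.

(** Fubini's theorem for [R^(p + q)], transported along the concatenation of rows. *)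
Lemma cint_row_mx p q (F : 'rV[R]_(p + q) -> R[i])
    (A : 'rV[R]_p -> R) (B : 'rV[R]_q -> R) :
  (forall y, 0 <= A y) -> (forall w, 0 <= B w) ->
  (lebesgue_rV p).-integrable setT (EFin \o A) ->
  (lebesgue_rV q).-integrable setT (EFin \o B) ->
  cmeasurable F -> (forall y w, normc (F (row_mx y w)) <= A y * B w) ->
  cint (lebesgue_rV (p + q)) F =
  cint (lebesgue_rV p) (fun y => cint (lebesgue_rV q) (fun w => F (row_mx y w))).
Proof.
move=> A0 B0 iA iB mF FAB.
pose rw (z : 'rV[R]_p * 'rV[R]_q) := row_mx z.1 z.2.
have mrw : measurable_fun setT rw by exact: measurable_row_mx.
have mFrw : cmeasurable (F \o rw) by exact: (cmeasurableT_comp mF mrw).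
rewrite -(cint_prod12 A0 B0 iA iB mFrw)//.
have [ir ii] : cintegrable (lebesgue_rV p \x lebesgue_rV q)%E (F \o rw).
  by apply: (le_cintegrable mFrw (integrable_tensor A0 B0 iA iB)) => -[y w]; exact: FAB.
have E (h : 'rV[R]_(p + q) -> R) : measurable_fun setT h ->
    (lebesgue_rV p \x lebesgue_rV q)%E.-integrable setT (EFin \o (h \o rw)) ->
    \int[lebesgue_rV (p + q)]_v h v = \int[(lebesgue_rV p \x lebesgue_rV q)%E]_z h (rw z).
  move=> mh ih; congr fine.
  transitivity (\int[pushforward (lebesgue_rV p \x lebesgue_rV q)%E rw]_v (h v)%:E)%E.
    apply: eq_measure_integral => S mS _.
    exact: lebesgue_rV_row_mx.
  by rewrite (@integral_pushforward _ _ _ _ _ rw mrw _ setT (EFin \o h))//; exact/measurable_EFinP.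
by congr (_ +i* _); apply: E => //; [exact: mF.1|exact: mF.2].
Qed.

Section cells.
Variables (n : nat) (c : R) (c0 : 0 < c).

Let one (v : 'rV[R]_n) : R := \1_(closed_cell n c) v.

Lemma integrable_closed_cell :
  (lebesgue_rV n).-integrable setT (EFin \o (\1_(closed_cell n c) : 'rV[R]_n -> R)).
Proof.
apply/integrableP; split.
  by apply/measurable_EFinP; apply: measurable_indic; exact: measurable_closed_cell.
under eq_integral do rewrite /= ger0_norm//.
by rewrite integral_indic ?setIT; [exact: lebesgue_closed_cell|by []|exact: measurable_closed_cell].
Qed.

Lemma ge0_Rintegral_cells (f : 'rV[R]_n -> R) (A : 'rV[int]_n -> R) :
  measurable_fun setT f -> (forall v, 0 <= f v) -> weight A ->
  (forall l v, closed_cell n c v -> f (v + c *: zrow l) <= A l) ->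
  let a l := \int[lebesgue_rV n]_v (one v * f (v + c *: zrow l)) in
  [/\ (lebesgue_rV n).-integrable setT (EFin \o f), weight a &
      \int[lebesgue_rV n]_v f v = rsum a].
Proof.
move=> mf f0 wA fA a; have [A0 Aoo] := wA.
have mone : measurable_fun setT one by apply: measurable_indic; exact: measurable_closed_cell.
have mfl (l : 'rV[int]_n) : measurable_fun setT (fun v : 'rV[R]_n => f (v + c *: zrow l)).
  exact: (measurableT_comp mf (measurable_rV_add _)).
have mof l : measurable_fun setT (fun v => one v * f (v + c *: zrow l)).
  exact: measurable_funM.
have one0 v : 0 <= one v by rewrite /one.
pose V := fine (lebesgue_rV n (closed_cell n c)).
have VE : lebesgue_rV n (closed_cell n c) = V%:E.
  by rewrite fineK// ge0_fin_numE// lebesgue_closed_cell.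
have V0 : 0 <= V by rewrite fine_ge0.
have le l : (\int[lebesgue_rV n]_v (one v * f (v + c *: zrow l))%:E <= (V * A l)%:E)%E.
  have mcl := measurable_closed_cell n c.
  have -> : (V * A l)%:E = (\int[lebesgue_rV n]_v (A l * one v)%:E)%E.
    under eq_integral do rewrite EFinM.
    rewrite ge0_integralZl ?lee_fin//; [|exact/measurable_EFinP|by move=> v _; rewrite lee_fin].
    by rewrite integral_indic// setIT mulrC EFinM; congr (_ * _)%E; rewrite -VE.
  apply: ge0_le_integral => //.
  - by move=> v _; rewrite lee_fin mulr_ge0.
  - exact/measurable_EFinP.
  - by apply/measurable_EFinP; apply: measurable_funM.
  - move=> v _; rewrite lee_fin /one indicE.
    by case: (boolP (v \in _)) => [/set_mem|] vD; rewrite ?mul0r ?mulr0// mul1r mulr1 fA.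
have aE l : (a l)%:E = (\int[lebesgue_rV n]_v (one v * f (v + c *: zrow l))%:E)%E.
  rewrite /a /Rintegral fineK// ge0_fin_numE.
    by apply: le_lt_trans (le l) _; rewrite ltry.
  by apply: integral_ge0 => v _; rewrite lee_fin mulr_ge0.
have a0 l : 0 <= a l by apply: Rintegral_ge0 => v _; rewrite mulr_ge0.
have wa : weight a.
  apply: le_weight (weightZ V0 wA) => l.
  by rewrite a0 /= -lee_fin aE.
have intE : (\int[lebesgue_rV n]_v (f v)%:E = \esum_(l in [set: 'rV[int]_n]) (a l)%:E)%E.
  rewrite (@ge0_integral_cells _ _ c (EFin \o f))//; last exact/measurable_EFinP.
  apply: eq_esum => l _; rewrite aE integral_mkcond; apply: eq_integral => v _.
  rewrite /patch /one indicE; case: ifPn => _ /=; by rewrite ?mul1r ?mul0r.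
split => //; last by rewrite rsumE// /Rintegral intE.
apply/integrableP; split; first exact/measurable_EFinP.
under eq_integral do rewrite /= ger0_norm//.
by rewrite intE; exact: wa.2.
Qed.

(** The unfolding of an integral over [R^n] into the lattice translates of a
    fundamental cell.  Integrability comes out of the bound [A], which is
    uniform on the cell and summable over the lattice. *)
Lemma cint_cells (f : 'rV[R]_n -> R[i]) (A : 'rV[int]_n -> R) :
  cmeasurable f -> weight A ->
  (forall l v, closed_cell n c v -> normc (f (v + c *: zrow l)) <= A l) ->
  cintegrable (lebesgue_rV n) f /\
  cint (lebesgue_rV n) f =
  csum (fun l => cint (lebesgue_rV n) (fun v =>
    ((\1_(closed_cell n c) v : R)%:C) * f (v + c *: zrow l))).
Proof.
move=> [fr fi] wA fA.
have real_case (h : 'rV[R]_n -> R) : measurable_fun setT h ->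
    (forall l v, closed_cell n c v -> `|h (v + c *: zrow l)| <= A l) ->
    (lebesgue_rV n).-integrable setT (EFin \o h) /\
    \int[lebesgue_rV n]_v h v =
    rsum (fun l => \int[lebesgue_rV n]_v (one v * h (v + c *: zrow l))).
  move=> mh hA.
  (* The nonnegative case applies to both parts of [h]; the two sums recombine
     by [rsumB] though they are not the positive and negative parts of their
     difference. *)
  pose hp v := Num.max (h v) 0; pose hn v := Num.max (- h v) 0.
  have hE v : h v = hp v - hn v.
    rewrite /hp /hn; case: (lerP 0 (h v)) => h0.
      by rewrite (max_idPr _) ?oppr_le0// subr0.
    by rewrite (max_idPl _) ?oppr_ge0 ?ltW// opprK add0r.
  have mhp : measurable_fun setT hp by apply: measurable_maxr.
  have mhn : measurable_fun setT hn.
    by apply: measurable_maxr => //; exact: measurable_funN.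
  have hp0 v : 0 <= hp v by rewrite le_max lexx orbT.
  have hn0 v : 0 <= hn v by rewrite le_max lexx orbT.
  have A0 := wA.1.
  have hpA l v : closed_cell n c v -> hp (v + c *: zrow l) <= A l.
    by move=> vD; rewrite ge_max A0 andbT (le_trans (ler_norm _))// hA.
  have hnA l v : closed_cell n c v -> hn (v + c *: zrow l) <= A l.
    by move=> vD; rewrite ge_max A0 andbT (le_trans (ler_norm _))// normrN hA.
  have [ip wp Ep] := ge0_Rintegral_cells mhp hp0 wA hpA.
  have [iN wn En] := ge0_Rintegral_cells mhn hn0 wA hnA.
  split.
    rewrite (_ : EFin \o h = (EFin \o hp) \- (EFin \o hn))%E; first exact: integrableB.
    by apply: funext => v; rewrite /= hE.
  under eq_Rintegral do rewrite hE.
  rewrite RintegralB// Ep En -rsumB//; congr rsum; apply: funext => l.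
  have int_cell (k : 'rV[R]_n -> R) : measurable_fun setT k -> (forall v, 0 <= k v) ->
      (forall l v, closed_cell n c v -> k (v + c *: zrow l) <= A l) ->
      (lebesgue_rV n).-integrable setT (EFin \o (fun v => one v * k (v + c *: zrow l))).
    move=> mk k0 kA.
    apply: (@le_integrable _ _ _ _ setT measurableT _ (EFin \o (fun v => A l * one v))).
    - apply/measurable_EFinP/measurable_funM.
        by apply: measurable_indic; exact: measurable_closed_cell.
      exact: (measurableT_comp mk (measurable_rV_add _)).
    - move=> v _ /=; rewrite lee_fin /one indicE.
      case: (boolP (v \in _)) => [/set_mem|] vD; rewrite ?mul0r ?mulr0// mul1r mulr1.
      by rewrite !ger0_norm// kA.
    - exact: (integrableZl measurableT (A l) integrable_closed_cell).
  rewrite -RintegralB//; [|exact: int_cell..].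
  by apply: eq_Rintegral => v _; rewrite hE mulrBr.
have [ir Er] := real_case _ fr (fun l v vD => le_trans (normRe_le _) (fA l v vD)).
have [ii Ei] := real_case _ fi (fun l v vD => le_trans (normIm_le _) (fA l v vD)).
split; first by split.
rewrite /cint /csum /= Er Ei; congr (_ +i* _); congr rsum; apply: funext => l;
  apply: eq_Rintegral => v _.
- by rewrite ReM /= mul0r subr0.
- by rewrite ImM /= mul0r addr0.
Qed.

End cells.
End complex_lebesgue.

(** * Gaussians along a lattice *)

Section lattice_weights.
Context {R : realType}.

Lemma weight_geometric (q : R) : 0 <= q < 1 -> weight (fun k : nat => q ^+ k).
Proof.
move=> /andP[q0 q1]; split => [k|]; first exact: exprn_ge0.
rewrite -nneseries_esumT; last by move=> k; rewrite lee_fin exprn_ge0.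
apply: (@le_lt_trans _ _ ((1 - q)^-1)%:E); last by rewrite ltry.
apply: lime_le.
  by apply: is_cvg_nneseries => k _ _; rewrite lee_fin exprn_ge0.
apply: nearW => k; rewrite sumEFin lee_fin.
rewrite -[leRHS]mul1r ler_pdivlMr ?subr_gt0// mulrC -opprB mulNr.
by rewrite big_mkord -subrX1 opprB gerBl exprn_ge0.
Qed.

Lemma weight_int (q : R) : 0 <= q < 1 -> weight (fun k : int => q ^+ `|k|%N).
Proof.
move=> q01; have [q0 qoo] := weight_geometric q01.
have /andP[q0' q1] := q01.
split => [k|]; first exact: exprn_ge0.
rewrite (esumID (range Posz)); last by move=> k _; rewrite lee_fin exprn_ge0.
rewrite !setTI.
have -> : ~` range Posz = range Negz.
  apply/seteqP; split => [[k|k] /= H|_ [k _ <-] [j _]//]; last by exists k.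
  by exfalso; apply: H; exists k.
rewrite (@reindex_esum _ _ _ setT (range Posz) Posz); last first.
  by split => // i j _ _ [].
rewrite (@reindex_esum _ _ _ setT (range Negz) Negz); last first.
  by split => // i j _ _ [].
apply: lte_add_pinfty => //; apply: le_lt_trans qoo.
by apply: le_esum => k _; rewrite lee_fin /= exprS ler_piMl ?exprn_ge0// ltW.
Qed.

(** The sum over [Z^n] of a product of geometric weights is the [n]-th power of the
    sum over [Z]; only its finiteness is kept. *)
Lemma weight_rV n (q : R) : 0 <= q < 1 ->
  weight (fun l : 'rV[int]_n => \prod_i q ^+ `|l ord0 i|%N).
Proof.
move=> q01; have [q0 qoo] := weight_int q01.
elim: n => [|n [IH0 IHoo]]; split => [l|].
- by apply: prodr_ge0 => i _; exact: q0.
- rewrite (_ : [set: _] = [set 0]); last by apply/seteqP; split => // l _; rewrite /= thinmx0.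
  by rewrite esum_set1 big_ord0 ?lee_fin ?ltry.
- by apply: prodr_ge0 => i _; exact: q0.
pose e (z : int * 'rV[int]_n) : 'rV[int]_(1 + n) := row_mx (z.1)%:M z.2.
rewrite (@reindex_esum _ _ _ setT setT e); last first.
  split => //.
    move=> [a v] [b w] _ _ /eq_row_mx[/= /matrixP/(_ ord0 ord0) + ->].
    by rewrite !mxE eqxx !mulr1n => ->.
  move=> l _; exists (l ord0 (lshift n (ord0 : 'I_1)), rsubmx (l : 'rV_(1 + n))) => //.
  rewrite /e /= -[RHS](@hsubmxK _ 1 1 n); congr row_mx.
  by apply/rowP => i; rewrite !mxE !ord1 eqxx mulr1n.
have eE z : \prod_i q ^+ `|e z ord0 i|%N =
    q ^+ `|z.1|%N * \prod_i q ^+ `|z.2 ord0 i|%N.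
  rewrite (@big_split_ord _ _ _ 1 n) big_ord1 /=.
  by rewrite row_mxEl mxE eqxx mulr1n; under eq_bigr do rewrite row_mxEr.
rewrite (_ : [set: int * 'rV[int]_n] = [set: int] `*`` (fun=> setT)); last first.
  by apply/seteqP; split.
under eq_esum do rewrite eE.
rewrite -(@esum_esum _ _ _ setT (fun=> setT)
  (fun k l => (q ^+ `|k|%N * \prod_i q ^+ `|(l : 'rV[int]_n) ord0 i|%N)%:E)); last first.
  by move=> k l _ _; rewrite lee_fin mulr_ge0.
set S := (\esum_(i in _) _)%E in IHoo.
have S0 : (0 <= S)%E by apply: esum_ge0 => l _; rewrite lee_fin.
have Sfin : S = (fine S)%:E by rewrite fineK// ge0_fin_numE.
under eq_esum => k _.
  under eq_esum do rewrite EFinM.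
  rewrite esumZl//.
  rewrite -/S Sfin -EFinM mulrC; over.
by have [] := weightZ (fine_ge0 S0) (weight_int q01).
Qed.

(** With [t = x + 2 pi k] one has [|t| >= |k| - M] because [2 pi >= 1], whence
    [t^2 >= 2 |t| - 1 >= |k| - (2 M + 1)]: the linear minorant trades the
    Gaussian for a geometric weight that does not depend on [x]. *)
Lemma gaussian_le_geometric (c M x : R) (k : int) : 0 <= c -> `|x| <= M ->
  expR (- (c * (x + 2 * pi * k%:~R) ^+ 2)) <=
  expR (c * (2 * M + 1)) * expR (- c) ^+ `|k|%N.
Proof.
move=> c0 xM; rewrite -expRM_natl -expRD ler_expR mulrN lerNl opprD opprK.
rewrite [_%:R * c]mulrC addrC -mulrBr ler_wpM2l//.
set t := x + _.
have k_le : `|k|%:R <= `|t| + M.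
  have -> : `|k|%N%:R = `|k%:~R| :> R by rewrite natr_absz intr_norm.
  have pi1 : 1 <= 2 * pi :> R by have := @pi_ge2 R; lra.
  apply: (@le_trans _ _ `|2 * pi * k%:~R|).
    by rewrite normrM ler_peMl// ger0_norm; lra.
  rewrite (_ : 2 * pi * k%:~R = t - x); last by rewrite /t addrC addKr.
  by rewrite (le_trans (ler_normB _ _))// lerD2l.
have t2 : 2 * `|t| - 1 <= t ^+ 2.
  by rewrite -(real_normK (num_real t)); have := sqr_ge0 (`|t| - 1); lra.
have := normr_ge0 x; have := ler0n R `|k|; lra.
Qed.

Lemma gaussian_weight n (c M : R) : 0 < c ->
  exists2 A : 'rV[int]_n -> R, weight A & forall l (v : 'rV[R]_n),
    (forall i, `|v ord0 i| <= M) ->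
    expR (- (c * \sum_i (v + (2 * pi) *: zrow l) ord0 i ^+ 2)) <= A l.
Proof.
move=> c0; exists (fun l => expR (c * (2 * M + 1)) ^+ n *
    \prod_i expR (- c) ^+ `|l ord0 i|%N).
  apply: weightZ; first by rewrite exprn_ge0// expR_ge0.
  by apply: weight_rV; rewrite expR_ge0 -expR0 ltr_expR oppr_lt0.
move=> l v vM; rewrite mulr_sumr -sumrN expR_sum.
rewrite -[in X in _ <= X * _](card_ord n) -prodr_const -big_split /=.
apply: ler_prod => i _; rewrite expR_ge0 /= !mxE.
exact: gaussian_le_geometric (ltW c0) (vM i).
Qed.

Lemma continuous_sumr (T : topologicalType) I (s : seq I) (f : I -> T -> R) :
  (forall i, continuous (f i)) -> continuous (fun v => \sum_(i <- s) f i v).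
Proof.
move=> cf v; elim: s => [|i s IHs].
  under eq_fun do rewrite big_nil; exact: cvg_cst.
under eq_fun do rewrite big_cons.
by apply: cvgD => //; exact: cf.
Qed.

Lemma continuous_quadratic n (A : 'M[R]_n) :
  continuous (fun v : 'rV[R]_n => (v *m A *m v^T) ord0 ord0).
Proof.
rewrite (_ : (fun _ => _) =
    (fun v : 'rV[R]_n => \sum_j (\sum_i v ord0 i * A i j) * v ord0 j)).
  apply: (@continuous_sumr _ _ _ (fun j (v : 'rV[R]_n) =>
    (\sum_i v ord0 i * A i j) * v ord0 j)) => j v.
  have cl : continuous (fun v : 'rV[R]_n => \sum_i v ord0 i * A i j).
    apply: (@continuous_sumr _ _ _ (fun i (v : 'rV[R]_n) => v ord0 i * A i j)) => i w.
    by apply: continuousM; [exact: coord_continuous|exact: cst_continuous].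
  by apply: continuousM; [exact: cl|exact: coord_continuous].
by apply: funext => w; rewrite mxE; apply: eq_bigr => j _; rewrite !mxE.
Qed.

(** The form attains its maximum [- c] on the compact unit sphere, and [- c] is
    negative; the bound extends to the other vectors by homogeneity. *)
Lemma negative_definite_le n (A : 'M[R]_n) : negative_definite A ->
  exists2 c, 0 < c & forall v : 'rV[R]_n,
    (v *m A *m v^T) ord0 ord0 <= - (c * \sum_i v ord0 i ^+ 2).
Proof.
move=> Aneg; pose q (v : 'rV[R]_n) := (v *m A *m v^T) ord0 ord0.
pose s (v : 'rV[R]_n) := \sum_i v ord0 i ^+ 2.
have s0 v : 0 <= s v by apply: sumr_ge0 => i _; exact: sqr_ge0.
have s_eq0 v : s v = 0 -> v = 0.
  move/eqP; rewrite psumr_eq0 => [/allP H|i _]; last exact: sqr_ge0.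
  apply/rowP => i; rewrite mxE; apply/eqP; rewrite -sqrf_eq0.
  by apply: H; rewrite mem_index_enum.
have cs : continuous s.
  rewrite (_ : s = fun v => (v *m 1%:M *m v^T) ord0 ord0); first exact: continuous_quadratic.
  by apply: funext => v; rewrite mulmx1 mxE; apply: eq_bigr => i _; rewrite mxE expr2.
pose B : set 'rV[R]_n := [set v | s v = 1].
have cB : compact B.
  apply: (@subclosed_compact _ _ [set v : 'rV[R]_n | forall i, `[(-1), 1]%classic (v ord0 i)]).
  - rewrite (_ : B = s @^-1` [set 1])//.
    by apply: preimage_closed => // v _; exact: cs.
  - by apply: (@rV_compact _ _ (fun=> `[(-1 : R), 1]%classic)) => i; exact: segment_compact.
  - move=> v vB i; rewrite /= in_itv /= -ler_norml -(@ler_pXn2r _ 2) ?nnegrE//.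
    rewrite expr1n real_normK ?num_real// -vB /s (bigD1 i)//= lerDl.
    by apply: sumr_ge0 => j _; exact: sqr_ge0.
have scale v : v != 0 -> exists2 u, B u & v = Num.sqrt (s v) *: u.
  move=> v0; have sv0 : 0 < s v.
    by rewrite lt_neqAle s0 andbT eq_sym; apply: contra v0 => /eqP/s_eq0 ->.
  exists ((Num.sqrt (s v))^-1 *: v); last first.
    by rewrite scalerA mulfV ?scale1r// sqrtr_eq0 -ltNge.
  rewrite /B /= /s; under eq_bigr do rewrite mxE exprMn.
  rewrite -mulr_sumr -/(s v) exprVn sqr_sqrtr ?s0//. by apply: mulVf; exact: lt0r_neq0.
have qZ r u : q (r *: u) = r ^+ 2 * q u.
  by rewrite /q -!scalemxAl linearZ /= -scalemxAr !mxE mulrA expr2.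
(* The sphere is empty in dimension 0, where every constant works. *)
have [[u0 Bu0]|B0] := pselect (exists u, B u); last first.
  exists 1 => // v; have [->|/scale[u Bu]] := eqVneq v 0.
    by rewrite !mul0mx mxE big1 ?mulr0 ?oppr0// => i _; rewrite mxE expr0n.
  by exfalso; apply: B0; exists u.
have [w wB wmax] : exists2 w, w \in B & forall t, t \in B -> q t <= q w.
  apply: EVT_max_rV => //; first by exists u0.
  by apply: continuous_subspaceT; exact: continuous_quadratic.
have w0 : w != 0.
  apply/eqP => w0; move: wB; rewrite inE /B /= /s w0 big1 => [/esym/eqP|i _].
    by rewrite oner_eq0.
  by rewrite mxE expr0n.
exists (- q w) => [|v]; first by rewrite oppr_gt0; exact: Aneg.
rewrite mulNr opprK -/(q v) -/(s v).
have [->|/scale[u Bu vE]] := eqVneq v 0.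
  by rewrite /q !mul0mx mxE /s big1 ?mulr0// => i _; rewrite mxE expr0n.
rewrite [in leLHS]vE qZ sqr_sqrtr// mulrC ler_wpM2r//.
by apply: wmax; rewrite inE.
Qed.

End lattice_weights.

(** * Continuous functions and Gaussian kernels on row vectors *)

Section continuous_measurable.
Context {R : realType}.

(** The measurable sets are generated by the coordinates, so that open sets must be
    built from boxes: an open set is the union of the cells of side [1 / (N + 1)]
    that it contains, and there are countably many cells. *)
Lemma open_measurable_rV n (O : set 'rV[R]_n) : open O -> measurable O.
Proof.
move=> oO; pose side (N : nat) : R := N.+1%:R^-1.
pose Q (p : nat * 'rV[int]_n) := cell (side p.1) p.2.
pose F p := if `[< Q p `<=` O >] then Q p else set0.
have -> : O = \bigcup_p F p.
  apply/seteqP; split => [v Ov|v [p _]]; last first.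
    by rewrite /F; case: asboolP => // QO; exact: QO.
  have /nbhs_ballP[e /= e0 eO] : nbhs v O by exact: open_nbhs_nbhs.
  have [N Ne] : exists N, side N < e.
    exists (Num.truncn e^-1); rewrite /side invf_plt ?posrE//.
    exact: truncnS_gt.
  have sN : 0 < side N by rewrite invr_gt0.
  pose l := cell_index (side N) v.
  have Qv : Q (N, l) v by exact/cellP.
  exists (N, l) => //; rewrite /F asboolT// => w Qw; apply: eO; split => // i j.
  rewrite (ord1 i) -ball_normE /ball_ /= ltr_norml.
  have /andP[v1 v2] := Qv j; have /andP[w1 w2] := Qw j; apply/andP; split.
    by rewrite /= in v1 v2 w1 w2; lra.
  by rewrite /= in v1 v2 w1 w2; lra.
apply: countable_bigcupT_measurable => [|p]; first exact: countableP.
rewrite /F.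
by case: ifP => // _; exact: measurable_cell.
Qed.

Lemma continuous_measurable_rV n (f : 'rV[R]_n -> R) :
  continuous f -> measurable_fun setT f.
Proof.
move=> /continuousP cf; apply: (measurability _ (RGenOpens.measurableE R)).
move=> _ [_ [a [b ->] <-]]; rewrite setTI; apply: open_measurable_rV.
exact/cf/interval_open.
Qed.

Lemma compact_closed_cell n (c : R) : compact (closed_cell n c).
Proof.
rewrite closed_cellE; apply: (@rV_compact _ _ (fun=> `[0, c]%classic)) => i.
exact: segment_compact.
Qed.

Lemma continuous_bounded_closed_cell n (c : R) (f : 'rV[R]_n -> R) : 0 <= c ->
  continuous f -> exists C, forall v, closed_cell n c v -> `|f v| <= C.
Proof.
move=> c0 cf; have [||w _ wmax] := @EVT_max_rV R n (fun v => `|f v|) (closed_cell n c) _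
    (@compact_closed_cell n c).
- by exists 0 => i; rewrite mxE lexx.
- apply: continuous_subspaceT => v.
  by apply: continuous_comp; [exact: cf|exact: norm_continuous].
by exists `|f w| => v vD; apply: wmax; rewrite inE.
Qed.

End continuous_measurable.

Section quadform.
Context {R : realType}.
Variables (m n : nat) (S : 'M[R[i]]_(m + n)).

Lemma Re_sum I (s : seq I) (F : I -> R[i]) :
  complex.Re (\sum_(i <- s) F i) = \sum_(i <- s) complex.Re (F i).
Proof.
elim: s => [|i s IHs]; first by rewrite !big_nil.
by rewrite !big_cons -IHs; case: (F i) (\sum_(j <- s) _) => [a b] [].
Qed.

Lemma quadformE (x : 'rV[R]_m) (y : 'rV[R]_n) : quadform S x y =
  2^-1 * \sum_j (\sum_i (row_mx x y ord0 i)%:C * S i j) * (row_mx x y ord0 j)%:C.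
Proof.
rewrite /quadform mxE; congr (_ * _); apply: eq_bigr => j _; rewrite !mxE.
by congr (_ * _); apply: eq_bigr => i _; rewrite !mxE.
Qed.

Lemma Re_quadform (x : 'rV[R]_m) (y : 'rV[R]_n) :
  complex.Re (quadform S x y) = 2^-1 *
  (row_mx x y *m map_mx (@complex.Re R) S *m (row_mx x y)^T) ord0 ord0.
Proof.
rewrite quadformE (_ : 2^-1 = (2^-1 : R)%:C :> R[i]); last by rewrite fmorphV rmorph_nat.
rewrite ReM /= mul0r subr0; congr (_ * _); rewrite Re_sum mxE; apply: eq_bigr => j _.
rewrite ReM /= mulr0 subr0 Re_sum !mxE; congr (_ * _); apply: eq_bigr => i _.
by rewrite ReM /= mul0r subr0 !mxE.
Qed.

Lemma cmeasurable_quadform d (T : measurableType d) (x : 'rV[R]_m) (y : T -> 'rV[R]_n) :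
  measurable_fun setT y -> cmeasurable (fun t => quadform S x (y t)).
Proof.
move=> my; under eq_fun do rewrite quadformE.
have mc i : cmeasurable (fun t => (row_mx x (y t) ord0 i)%:C : R[i]).
  apply: cmeasurable_real; case: (split_ordP i) => j ->.
  - by under eq_fun do rewrite row_mxEl; exact: measurable_cst.
  - under eq_fun do rewrite row_mxEr.
    exact: (measurableT_comp (measurable_coord j) my).
apply: cmeasurableM; first exact: cmeasurable_cst.
apply: cmeasurable_sum => j; apply: cmeasurableM => //.
by apply: cmeasurable_sum => i; apply: cmeasurableM => //; exact: cmeasurable_cst.
Qed.

Lemma cmeasurable_gaussian d (T : measurableType d) (x : 'rV[R]_m) (y : T -> 'rV[R]_n) :
  measurable_fun setT y -> cmeasurable (fun t => cexp (quadform S x (y t))).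
Proof. by move=> my; apply: cmeasurable_cexp; exact: cmeasurable_quadform. Qed.

(** The domination on which all exchanges of sums and integrals rest. The point
    [x] is fixed while [y] ranges over the cube, hence the two radii [M] given to
    [gaussian_weight]. *)
Lemma gaussian_kernel_weight (x : 'rV[R]_m) :
  negative_definite (map_mx (@complex.Re R) S) ->
  exists A : 'rV[int]_m -> R, exists B : 'rV[int]_n -> R,
  [/\ weight A, weight B & forall k l y, @cube R n y ->
    normc (cexp (quadform S (x + (2 * pi) *: zrow k) (y + (2 * pi) *: zrow l)))
    <= A k * B l].
Proof.
move=> /negative_definite_le[c c0 Sc]; have c20 : 0 < 2^-1 * c by rewrite mulr_gt0// invr_gt0.
have [A wA HA] := @gaussian_weight R m _ (\sum_i `|x ord0 i|) c20.
have [B wB HB] := @gaussian_weight R n _ (2 * pi) c20.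
exists A, B; split => // k l y yc.
have xA := HA k x; have yB := HB l y.
rewrite normc_cexp Re_quadform.
set X := x + _ in xA *; set Y := y + _ in yB *.
apply: (@le_trans _ _ (expR (- (2^-1 * c * \sum_i X ord0 i ^+ 2)) *
                       expR (- (2^-1 * c * \sum_i Y ord0 i ^+ 2)))).
  rewrite -expRD ler_expR.
  apply: (@le_trans _ _ (2^-1 * - (c * \sum_i row_mx X Y ord0 i ^+ 2))).
    by rewrite ler_wpM2l ?invr_ge0.
  rewrite big_split_ord /=.
  under eq_bigr do rewrite row_mxEl.
  under [X in _ + X]eq_bigr do rewrite row_mxEr.
  by rewrite mulrN -opprD -mulrDr mulrA.
apply: ler_pM; rewrite ?expR_ge0//.
- by apply: xA => i; rewrite (bigD1 i)//= lerDl sumr_ge0.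
- by apply: yB => i; have /andP[y0 y2] := yc i; rewrite ger0_norm.
Qed.

End quadform.

(** * The common value of both sides on the torus *)

Section unfolding.
Context {R : realType}.
Variables (m n : nat) (S : 'M[R[i]]_(m + n)) (g : 'rV[R]_n -> 'rV[R]_n -> R[i]).
Variables (x : 'rV[R]_m) (A : 'rV[int]_m -> R) (B : 'rV[int]_n -> R) (C : R).
Hypotheses (wA : weight A) (wB : weight B) (C0 : 0 <= C).

Definition shifted_gaussian (k : 'rV[int]_m) (l : 'rV[int]_n) (y : 'rV[R]_n) : R[i] :=
  cexp (quadform S (x + (2 * pi) *: zrow k) (y + (2 * pi) *: zrow l)).

Local Notation E := shifted_gaussian.

Hypothesis E_le : forall k l y, @cube R n y -> normc (E k l y) <= A k * B l.
Hypothesis g_meas : cmeasurable (fun z : 'rV[R]_(n + n) => g (lsubmx z) (rsubmx z)).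
Hypothesis g_le : forall y eta, @cube R n y -> @cube R n eta -> normc (g y eta) <= C.
Hypothesis g_quasi : forall (k : 'rV[int]_n) y eta,
  g (y + (2 * pi) *: zrow k) eta = expi (- dotr (zrow k) eta) * g y eta.

(** The common summand of both sides: the contribution of the translates [k]
    and [l] to the theta-kernel, tested against [g] on the fundamental cube. *)
Definition torus_term k l (z : 'rV[R]_(n + n)) : R[i] :=
  (\1_(@cube R (n + n)) z)%:C *
  (E k l (lsubmx z) * expi (- dotr (zrow l) (rsubmx z)) * g (lsubmx z) (rsubmx z)).

Lemma cube_row_mx p q (y : 'rV[R]_p) (w : 'rV[R]_q) :
  @cube R (p + q) (row_mx y w) <-> @cube R p y /\ @cube R q w.
Proof.
split => [H|[Hy Hw] i].
  split => i; first by have := H (lshift q i); rewrite row_mxEl.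
  by have := H (rshift p i); rewrite row_mxEr.
by case: (split_ordP i) => j ->; rewrite ?row_mxEl ?row_mxEr.
Qed.

Lemma indic_cube_row_mx p q (y : 'rV[R]_p) (w : 'rV[R]_q) :
  \1_(@cube R (p + q)) (row_mx y w) = \1_(@cube R p) y * \1_(@cube R q) w :> R.
Proof.
rewrite !indicE -natrM mulnb; congr ((nat_of_bool _)%:R); apply/idP/andP.
- by move=> /set_mem /cube_row_mx[? ?]; rewrite !mem_set.
- by move=> [/set_mem ? /set_mem ?]; apply/mem_set/cube_row_mx.
Qed.

Lemma torus_term_le k l z :
  normc (torus_term k l z) <= A k * (B l * (C * \1_(@cube R (n + n)) z)).
Proof.
rewrite /torus_term indicE; case: (boolP (z \in _)) => [/set_mem|] zc; last first.
  by rewrite mul0r !mulr0 /= expr0n /= addr0 sqrtr0.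
rewrite mul1r mulr1 normcM (normcM (E k l _)) normc_expi mulr1 mulrA.
rewrite -(hsubmxK z) in zc; have [yc ec] := (cube_row_mx _ _).1 zc.
by apply: ler_pM; rewrite ?normc_ge0 ?E_le ?g_le.
Qed.

Lemma cmeasurable_expi_dotr p (v : 'rV[R]_p) d (T : measurableType d) (f : T -> 'rV[R]_p) :
  measurable_fun setT f -> cmeasurable (fun t => expi (- dotr v (f t)) : R[i]).
Proof.
move=> mf; apply: cmeasurable_cexp; split => /=; first exact: measurable_cst.
apply: measurable_funN; apply: measurable_sum => i; apply: measurable_funM.
  exact: measurable_cst.
exact: (measurableT_comp (measurable_coord i) mf).
Qed.

Lemma cmeasurable_shifted_gaussian k l d (T : measurableType d) (f : T -> 'rV[R]_n) :
  measurable_fun setT f -> cmeasurable (fun t => E k l (f t)).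
Proof.
move=> mf; apply: cmeasurable_gaussian.
exact: (measurableT_comp (measurable_rV_add _) mf).
Qed.

Lemma measurable_cube p : measurable (@cube R p).
Proof. exact: measurable_closed_cell. Qed.

Lemma integrable_cube p (a : R) :
  (lebesgue_rV p).-integrable setT (EFin \o (fun v : 'rV[R]_p => a * \1_(@cube R p) v)).
Proof. exact: (integrableZl measurableT a (integrable_closed_cell p (2 * pi))). Qed.

Lemma cmeasurable_torus_term k l : cmeasurable (torus_term k l).
Proof.
apply: cmeasurableM; first by apply: cmeasurable_indic; exact: measurable_cube.
apply: cmeasurableM; last exact: g_meas.
apply: cmeasurableM.
  exact: (cmeasurable_shifted_gaussian k l (@measurable_lsubmx R n n)).
exact: (cmeasurable_expi_dotr (zrow l) (@measurable_rsubmx R n n)).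
Qed.

Definition torus_coef k l : R[i] := cint (lebesgue_rV (n + n)) (torus_term k l).

Let V : R := \int[lebesgue_rV (n + n)]_z (C * \1_(@cube R (n + n)) z).

Let V0 : 0 <= V.
Proof. by apply: Rintegral_ge0 => z _; rewrite mulr_ge0. Qed.

Lemma torus_coef_le k l : normc (torus_coef k l) <= A k * (2 * V * B l).
Proof.
apply: le_trans (_ : 2 * \int[lebesgue_rV (n + n)]_z
    (A k * (B l * C) * \1_(@cube R (n + n)) z) <= _).
  apply: normc_cint_le; first exact: cmeasurable_torus_term.
  - exact: integrable_cube.
  - by move=> z; rewrite (le_trans (torus_term_le _ _ _))// !mulrA.
have -> : \int[lebesgue_rV (n + n)]_z (A k * (B l * C) * \1_(@cube R (n + n)) z) =
    A k * B l * V.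
  rewrite -RintegralZl//; last exact: integrable_cube.
  by apply: eq_Rintegral => z _; rewrite !mulrA.
by rewrite le_eqVlt; apply/orP; left; apply/eqP; ring.
Qed.

(** The outer sum over [k] converges like the weight [A]. *)
Lemma csum_torus_coef_le :
  exists2 D, 0 <= D & forall k, normc (csum (torus_coef k)) <= D * A k.
Proof.
have wV : weight (fun l => 2 * V * B l) by apply: weightZ => //; rewrite mulr_ge0.
exists (2 * rsum (fun l => 2 * V * B l)) => [|k].
  rewrite mulr_ge0// rsumE// fine_ge0// esum_ge0// => l _; rewrite lee_fin.
  exact: wV.1.
rewrite mulrC mulrCA -rsumZ ?wA.1//.
by apply: normc_csum_le (torus_coef_le k); apply: weightZ => //; exact: wA.1.
Qed.

(** The inverse Zak transform of [g] without its factor [(2 pi)^(-n)]. *)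
Definition zak_inv_integral y : R[i] :=
  cint (lebesgue_rV n) (fun eta => (\1_(@cube R n) eta)%:C * g y eta).

Lemma cmeasurable_g_row : cmeasurable (fun z : 'rV[R]_n * 'rV[R]_n => g z.1 z.2).
Proof.
have := cmeasurableT_comp g_meas (@measurable_row_mx R n n).
by under eq_fun do rewrite row_mxKl row_mxKr.
Qed.

Lemma cmeasurable_zak_inv_integral : cmeasurable zak_inv_integral.
Proof.
apply: (@cmeasurable_cint _ _ _ _ _ (lebesgue_rV n)
  (fun z : 'rV[R]_n * 'rV[R]_n => (\1_(@cube R n) z.2)%:C * g z.1 z.2)).
apply: cmeasurableM; last exact: cmeasurable_g_row.
apply: (@cmeasurableT_comp _ _ _ _ _ (fun v : 'rV[R]_n => (\1_(@cube R n) v)%:C : R[i]) snd) => //.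
by apply: cmeasurable_indic; exact: measurable_cube.
Qed.

Lemma g_shift_le l y eta : @cube R n y ->
  normc ((\1_(@cube R n) eta)%:C * g (y + (2 * pi) *: zrow l) eta)
  <= C * \1_(@cube R n) eta.
Proof.
move=> yc; rewrite indicE; case: (boolP (eta \in _)) => [/set_mem|] ec; last first.
  by rewrite mul0r mulr0 /= expr0n /= addr0 sqrtr0.
by rewrite mul1r mulr1 g_quasi normcM normc_expi mul1r g_le.
Qed.

Lemma cmeasurable_g_shift y :
  cmeasurable (fun eta => (\1_(@cube R n) eta)%:C * g y eta).
Proof.
apply: cmeasurableM; first by apply: cmeasurable_indic; exact: measurable_cube.
exact: (cmeasurableT_comp cmeasurable_g_row (measurable_pair1 y)).
Qed.

Let W : R := \int[lebesgue_rV n]_eta (C * \1_(@cube R n) eta).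

Lemma zak_inv_integral_le l y : @cube R n y ->
  normc (zak_inv_integral (y + (2 * pi) *: zrow l)) <= 2 * W.
Proof.
move=> yc; apply: normc_cint_le; first exact: cmeasurable_g_shift.
- exact: integrable_cube.
- by move=> eta; exact: g_shift_le.
Qed.

(** The quasi-periodicity of [g] enters here: it is what produces the factor
    [e^(- i l.eta)] of the theta-kernel. *)
Lemma unfold_slice k l (v : 'rV[R]_n) :
  (\1_(@cube R n) v)%:C * (E k l v * zak_inv_integral (v + (2 * pi) *: zrow l)) =
  cint (lebesgue_rV n) (fun eta => torus_term k l (row_mx v eta)).
Proof.
case: (pselect (@cube R n v)) => vc; last first.
  rewrite indicE memNset// mul0r -[LHS](@cint0 _ _ _ (lebesgue_rV n)).
  apply: eq_cint => eta; rewrite /torus_term indic_cube_row_mx.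
  by rewrite [\1_(@cube R n) v]indicE memNset// !mul0r.
rewrite indicE mem_set// mul1r -cintZ; last first.
  apply: (le_cintegrable (cmeasurable_g_shift _) (integrable_cube n C)) => eta.
  exact: g_shift_le.
apply: eq_cint => eta; rewrite /torus_term indic_cube_row_mx row_mxKl row_mxKr.
rewrite [\1_(@cube R n) v]indicE mem_set// mul1r g_quasi.
by rewrite mulrCA -mulrA.
Qed.

(** Integrability is stated along with the value, so that the constant
    [(2 pi)^(-n)] can be taken out of the integral. *)
Lemma unfold_gauss k (f := fun y =>
    cexp (quadform S (x + (2 * pi) *: zrow k) y) * zak_inv_integral y) :
  cintegrable (lebesgue_rV n) f /\ cint (lebesgue_rV n) f = csum (torus_coef k).
Proof.
have A0 := wA.1; have B0 := wB.1.
have W0 : 0 <= W by apply: Rintegral_ge0 => z _; rewrite mulr_ge0.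
have pi0 : 0 < 2 * pi :> R by rewrite mulr_gt0// pi_gt0.
have mf : cmeasurable f.
  apply: cmeasurableM; last exact: cmeasurable_zak_inv_integral.
  exact: cmeasurable_gaussian.
have wAB : weight (fun l => A k * (2 * W) * B l).
  by apply: weightZ => //; rewrite !mulr_ge0.
have [|if_ ->] := cint_cells pi0 mf wAB.
  move=> l v vc; rewrite normcM mulrAC.
  by apply: ler_pM; rewrite ?normc_ge0//; [exact: E_le|exact: zak_inv_integral_le].
split => //; apply: eq_csum => l; rewrite /torus_coef.
rewrite (@cint_row_mx _ n n _ (fun y => A k * B l * \1_(@cube R n) y)
  (fun w => C * \1_(@cube R n) w)).
- by apply: eq_cint => v; rewrite -unfold_slice.
- by move=> y; rewrite !mulr_ge0.
- by move=> y; rewrite mulr_ge0.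
- exact: integrable_cube.
- exact: integrable_cube.
- exact: cmeasurable_torus_term.
- move=> y w; rewrite (le_trans (torus_term_le _ _ _))// indic_cube_row_mx.
  by rewrite le_eqVlt; apply/orP; left; apply/eqP; ring.
Qed.

(** Outside the cube, where the summability of the kernel is not controlled, the
    indicator makes both sides vanish. *)
Lemma theta_kernel_torus_term (xi : 'rV[R]_m) z :
  (\1_(@cube R (n + n)) z)%:C *
    (theta_kernel S x xi (lsubmx z) (rsubmx z) * g (lsubmx z) (rsubmx z)) =
  csum (fun k => expi (dotr (zrow k) xi) * csum (fun l => torus_term k l z)).
Proof.
have A0 := wA.1.
case: (pselect (@cube R (n + n) z)) => zc; last first.
  rewrite indicE memNset// mul0r -[LHS](@csum0 R 'rV[int]_m); apply: eq_csum => k.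
  rewrite -[LHS](mulr0 (expi (dotr (zrow k) xi))) -(@csum0 R 'rV[int]_n).
  by congr (_ * _); apply: eq_csum => l; rewrite /torus_term indicE memNset// mul0r.
rewrite indicE mem_set// mul1r.
have := zc; rewrite -{1}(hsubmxK z) => /cube_row_mx[yc ec].
set y := lsubmx z in yc *; set eta := rsubmx z in ec *.
pose u k l := E k l y * expi (- dotr (zrow l) eta).
have u_le k l : normc (u k l) <= A k * B l.
  by rewrite /u normcM normc_expi mulr1 E_le.
have wAB k : weight (fun l => A k * B l) by exact: weightZ.
have kernelE : theta_kernel S x xi y eta =
    csum (fun k => expi (dotr (zrow k) xi) * csum (u k)).
  apply: eq_csum => k; rewrite -(csumZ _ (wAB k) (u_le k)).
  by apply: eq_csum => l; rewrite /u mulrAC mulrC.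
rewrite kernelE mulrC -(@csumZ _ _ _ _ (fun k => 2 * rsum B * A k)); last 2 first.
- by apply: weightZ => //; rewrite mulr_ge0// rsumE// fine_ge0// esum_ge0// => l _; rewrite lee_fin wB.1.
- move=> k; rewrite normcM normc_expi mul1r (le_trans (normc_csum_le (wAB k) (u_le k)))//.
  by rewrite rsumZ// -mulrA [A k * _]mulrC.
apply: eq_csum => k; rewrite mulrCA; congr (_ * _).
rewrite -(csumZ _ (wAB k) (u_le k)); apply: eq_csum => l.
by rewrite /torus_term indicE mem_set// mul1r mulrC.
Qed.

Lemma cint_theta_kernel (xi : 'rV[R]_m) :
  cintegral (@cube R (n + n)) (fun z =>
    theta_kernel S x xi (lsubmx z) (rsubmx z) * g (lsubmx z) (rsubmx z)) =
  csum (fun k => expi (dotr (zrow k) xi) * csum (torus_coef k)).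
Proof.
have A0 := wA.1.
have wAB k : weight (fun l => A k * B l) by exact: weightZ.
have B0 : 0 <= rsum B.
  by rewrite rsumE// fine_ge0// esum_ge0// => l _; rewrite lee_fin wB.1.
pose h (z : 'rV[R]_(n + n)) : R := C * \1_(@cube R (n + n)) z.
have h0 z : 0 <= h z by rewrite mulr_ge0.
have term_le k z : normc (csum (fun l => torus_term k l z)) <= A k * (2 * rsum B * h z).
  have bound l : normc (torus_term k l z) <= A k * h z * B l.
    by rewrite (le_trans (torus_term_le _ _ _))// mulrAC -mulrA.
  have wk : weight (fun l => A k * h z * B l) by apply: weightZ; rewrite // mulr_ge0.
  rewrite (le_trans (normc_csum_le wk bound))// rsumZ ?mulr_ge0//.
  by rewrite le_eqVlt; apply/orP; left; apply/eqP; ring.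
have mterm k : cmeasurable (fun z => csum (fun l => torus_term k l z)).
  by apply: cmeasurable_csum => l; exact: cmeasurable_torus_term.
have ih : (lebesgue_rV (n + n)).-integrable setT (EFin \o (fun z => 2 * rsum B * h z)).
  exact: (integrableZl measurableT (2 * rsum B) (integrable_cube (n + n) C)).
rewrite cintegral_indic; under eq_cint do rewrite theta_kernel_torus_term.
rewrite (@cint_csum _ _ _ _ _ (fun k z => expi (dotr (zrow k) xi) *
    csum (fun l => torus_term k l z)) A (fun z => 2 * rsum B * h z))//.
- apply: eq_csum => k; rewrite cintZ; last first.
    apply: (le_cintegrable (mterm k) (integrableZl measurableT (A k) ih)) => z.
    exact: term_le.
  congr (_ * _).
  rewrite (@cint_csum _ _ _ _ _ (torus_term k) (fun l => A k * B l) h)//.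
  + by move=> l; exact: cmeasurable_torus_term.
  + exact: integrable_cube.
  + by move=> l z; rewrite (le_trans (torus_term_le _ _ _))// mulrA.
- by move=> k; apply: cmeasurableM => //; exact: cmeasurable_cst.
- by move=> z; rewrite !mulr_ge0.
- by move=> k z; rewrite normcM normc_expi mul1r.
Qed.

End unfolding.

(** * The intertwining relation *)

(** The left side collects the factors of the Gauss operator and of the inverse Zak
    transform; both exponents are [- m / 4 - 5 n / 4]. *)
Lemma theta_normalisation (R : realType) (m n : nat) (t : R) : 0 < t ->
  t `^ (- ((m + n)%:R / 4)) * t ^- n =
  t `^ ((m%:R - n%:R) / 2) * t `^ (- (3 * (n + m)%:R / 4)).
Proof.
move=> t0; have t_neq0 : t != 0 by rewrite gt_eqF.
rewrite -powR_mulrn ?ltW// -powRN -!powRD; try by rewrite t_neq0 implybT.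
by congr (_ `^ _); rewrite !natrD; field.
Qed.

(* The constants in the definitions of the Gauss operators, of the (not
   unitarily normalised) Zak transform and of the theta-operators force the
   numerical factor (2 pi)^((m - n)/2); it equals 1 when m = n. *)
Theorem theorem3p4 (R : realType) (m n : nat) (S : 'M[R[i]]_(m + n))
  (S_sym : S^T = S)
  (S_neg : negative_definite (map_mx (@complex.Re R) S))
  (g : 'rV[R]_n -> 'rV[R]_n -> R[i]) (gG : spaceG g)
  (x xi : 'rV[R]_m) :
  zak (gauss_op S (zak_inv g)) x xi
  = ((2 * pi) `^ ((m%:R - n%:R) / 2))%:C * theta_op S g x xi.
Proof.
have pi0 : 0 < 2 * pi :> R by rewrite mulr_gt0// pi_gt0.
have [[/(_ [::])[gRe _] /(_ [::])[gIm _]] _ g_quasi] := gG.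
have g_meas : cmeasurable (fun z : 'rV[R]_(n + n) => g (lsubmx z) (rsubmx z)).
  by split; exact: continuous_measurable_rV.
have [C1 g1] := continuous_bounded_closed_cell (ltW pi0) gRe.
have [C2 g2] := continuous_bounded_closed_cell (ltW pi0) gIm.
have g_le y eta : @cube R n y -> @cube R n eta -> normc (g y eta) <= C1 + C2.
  move=> yc ec; have zc : @cube R (n + n) (row_mx y eta) by apply/cube_row_mx.
  rewrite (le_trans (normc_le_ReIm _))// lerD//.
  - by have := g1 _ zc; rewrite /= row_mxKl row_mxKr.
  - by have := g2 _ zc; rewrite /= row_mxKl row_mxKr.
have C0 : 0 <= C1 + C2.
  have z0 p : @cube R p 0 by move=> i; rewrite mxE lexx ltW.
  exact: le_trans (normc_ge0 _) (g_le 0 0 (z0 n) (z0 n)).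
have [A [B [wA wB E_le]]] := gaussian_kernel_weight x S_neg.
have unfold := unfold_gauss wA wB C0 E_le g_meas g_le g_quasi.
have [D D0 coef_le] := csum_torus_coef_le wA wB C0 E_le g_meas g_le.
rewrite /theta_op (cint_theta_kernel wA wB C0 E_le g_meas g_le).
pose a : R := (2 * pi) `^ (- ((m + n)%:R / 4)); pose b : R := (2 * pi) ^- n.
have gaussE k : gauss_op S (zak_inv g) (x + (2 * pi) *: zrow k) =
    (a * b)%:C * csum (torus_coef S g x k).
  have [int_k <-] := unfold k.
  transitivity (a%:C * (b%:C * cint (lebesgue_rV n) (fun y =>
      cexp (quadform S (x + (2 * pi) *: zrow k) y) * zak_inv_integral g y))).
    rewrite -(cintZ b%:C int_k); congr (_ * _).
    rewrite cintegralT; apply: eq_cint => y.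
    by rewrite /zak_inv cintegral_indic mulrCA.
  by rewrite mulrA -rmorphM.
transitivity ((a * b)%:C *
    csum (fun k => expi (dotr (zrow k) xi) * csum (torus_coef S g x k))).
  rewrite -(@csumZ _ _ _ _ (fun k => D * A k)).
  - by apply: eq_csum => k; rewrite gaussE mulrAC mulrA.
  - exact: weightZ.
  - by move=> k; rewrite normcM normc_expi mul1r.
rewrite mulrA -rmorphM; congr (_%:C * _).
exact: theta_normalisation.
Qed.
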